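(* Let $G$ be a simple, $d$-regular, connected graph on $n$ vertices, where $d=d(n)$ may depend on $n$, and let $\lambda_2=\lambda_2(\tilde A_G)$. Then, as $n\to\infty$, $$m_G\left(\left[\left(1-\frac{\log\log_d n}{\log_d n}\right)\lambda_2,\ \lambda_2\right]\right)=\begin{cases}\widetilde O\left(\dfrac{n}{d}\right) & \text{when } d=o(\log^{1/4}n),\\[2mm] \widetilde O\left(\dfrac{n\log^{1/2}d}{\log^{1/4}n}\right) & \text{when } d=\Omega(\log^{1/4}n).\end{cases}$$
   Context: A simple graph is a finite undirected graph without multiedges or self-loops. $A_G$ is the adjacency matrix, and since $G$ is $d$-regular the normalized adjacency matrix is $\tilde A_G=\frac1d A_G$, with eigenvalues $\lambda_1\ge\lambda_2\ge\dots\ge\lambda_n$. For an interval $I$, $m_G(I)$ is the number of eigenvalues of $\tilde A_G$ in $I$, counted with multiplicity. Logarithms are natural unless a base is indicated. $\widetilde O(\cdot)$ suppresses factors polynomial in $\log\log n$; the bounds are meant uniformly over all graphs $G$ with the given $n$ and $d=d(n)$: i.e. for a given function $d(n)\geq 2$ in the stated regime there are constants $C,n_0$ such that for all $n\ge n_0$ and all such $G$ the count is at most $C(\log\log n)^C$ times the displayed expression. *)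

(* Defs.v *)
From HB Require Import structures.
From mathcomp Require Import all_boot all_order all_algebra.
From mathcomp Require Import polyrcf.
From mathcomp Require Import all_classical all_reals all_analysis.

Set Implicit Arguments.
Unset Strict Implicit.
Unset Printing Implicit Defensive.

Import Order.TTheory GRing.Theory Num.Theory.
Import numFieldNormedType.Exports.

Local Open Scope ring_scope.

Record sgraph (n : nat) := SGraph {
  adj :> rel 'I_n;
  adj_sym : symmetric adj;
  adj_irr : irreflexive adj }.

Definition regular n (d : nat) (G : sgraph n) : Prop :=
  forall v : 'I_n, #|[pred w | G v w]| = d.

Definition connected_graph n (G : sgraph n) : Prop :=
  forall v w : 'I_n, connect G v w.

Section Spectrum.
Variable R : realType.

Definition adjmx n (G : sgraph n) : 'M[R]_n := \matrix_(i, j) (G i j)%:R.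

Definition nadjmx n (d : nat) (G : sgraph n) : 'M[R]_n := d%:R^-1 *: adjmx G.

(* The real roots of the characteristic polynomial, each repeated according to
   its multiplicity, in nonincreasing order.  For a symmetric matrix these are
   all the complex roots, so the sequence has length n. *)
Definition eigenvalues n (A : 'M[R]_n) : seq R :=
  let p := char_poly A in
  sort >=%R (flatten [seq nseq (mup x p) x | x <- rootsR p]).

(* lambda_k, with k starting from 1 *)
Definition lambda n (A : 'M[R]_n) (k : nat) : R := nth 0 (eigenvalues A) k.-1.

Definition eig_count n (A : 'M[R]_n) (I : interval R) : nat :=
  count (fun x => x \in I) (eigenvalues A).

Definition log (b x : R) : R := ln x / ln b.

(* softO P f g: f = \tilde O(g), uniformly over the graphs G on n vertices
   satisfying P n G. *)
Definition softO (P : forall n, sgraph n -> Prop)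
    (f : forall n, sgraph n -> R) (g : nat -> R) : Prop :=
  exists C : R, 0 < C /\
  exists n0 : nat, forall n, (n0 <= n)%N -> forall G : sgraph n, P n G ->
    f n G <= C * ln (ln n%:R) `^ C * g n.

End Spectrum.

(* Main.v *)
(** Let [A] be the adjacency matrix, [rho = d * lambda_2], [k] a small multiple of
    [log_d n] and [s] a small multiple of [min(d, (ln n)^(1/4) / (ln d)^(1/2))].
    Two separated balls of radius [2k] cannot both carry test vectors of Rayleigh
    quotient above [rho], so after deleting [n^(1/2)] vertices every remaining
    vertex [x] is the centre of a ball on which the form of [A] is at most
    [rho], and at most [rho^(2k)] closed walks of length [2k] start at [x].

    A set [B] of at most [s <= d] vertices has a neighbour outside it at its
    largest test vector entry; adding this neighbour shows that the form of [A]
    on [B] is at most [rho (1 - 1/(4 s^3))].  Summing over the at most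
    [(s d + 1)^s] connected sets [B] containing [x], closed walks with at most
    [s] distinct vertices are a negligible fraction of [rho^(2k)].  The walks
    with more distinct vertices are almost all killed by deleting a further
    [n ln ln n / s] vertices, chosen greedily.  Hence the trace of the [2k]-th power of
    what is left is small, it has few eigenvalues close to [rho], and by
    interlacing so has [A], up to the number of deleted vertices. *)

Require Import Defs.
From mathcomp Require Import all_boot all_order all_algebra.
From mathcomp Require Import complex polyrcf ring lra zify.
From mathcomp Require Import all_classical all_reals all_analysis.

Set Implicit Arguments.
Unset Strict Implicit.
Unset Printing Implicit Defensive.

Import Order.TTheory GRing.Theory Num.Theory.
Import numFieldNormedType.Exports.

(** * Walks, balls and hitting sets *)

Section Walks.
Variables (T : finType) (e : rel T).

Definition nbhd (B : {set T}) : {set T} := [set y | [exists z in B, e z y]].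

Fixpoint gball (r : nat) (x : T) : {set T} :=
  if r is r'.+1 then gball r' x :|: nbhd (gball r' x) else [set x].

(* The starting vertex [x] is not listed. *)
Fixpoint walks (m : nat) (x : T) : seq (seq T) :=
  if m is m'.+1 then flatten [seq [seq y :: p | p <- walks m' y] | y <- enum (e x)]
  else [:: [::]].

Definition visited (x : T) (p : seq T) : {set T} := [set z in x :: p].

(* The connected sets that arise from [x] by adding at most [i] vertices, one
   neighbour at a time. *)
Fixpoint grown_sets (i : nat) (x : T) : seq {set T} :=
  if i is i'.+1 then
    grown_sets i' x ++
    flatten [seq [seq z |: B | z <- enum (nbhd B)] | B <- grown_sets i' x]
  else [:: [set x]].

Lemma nbhdP (B : {set T}) y : reflect (exists2 z, z \in B & e z y) (y \in nbhd B).
Proof. by rewrite inE; exact: exists_inP. Qed.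

Lemma gball_center r x : x \in gball r x.
Proof. by elim: r => [|r IH] /=; rewrite inE // IH. Qed.

Lemma gball_step r x y z : y \in gball r x -> e y z -> z \in gball r.+1 x.
Proof.
by move=> yB yz; rewrite /= inE; apply/orP; right; apply/nbhdP; exists y.
Qed.

Lemma gball_trans r r' x y z :
  y \in gball r x -> z \in gball r' y -> z \in gball (r + r') x.
Proof.
move=> yB; elim: r' z => [|r' IH] z; first by rewrite addn0 inE => /eqP->.
rewrite addnS /= inE => /orP[/IH zB|/nbhdP[w /IH wB wz]].
  by rewrite inE zB.
exact: gball_step wB wz.
Qed.

Lemma gball_le r r' x : r <= r' -> gball r x \subset gball r' x.
Proof.
by move=> /subnKC <-; apply/fintype.subsetP => y /gball_trans; apply; exact: gball_center.
Qed.

Lemma gball_sym r x y : symmetric e -> y \in gball r x -> x \in gball r y.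
Proof.
move=> se; elim: r y => [|r IH] y; first by rewrite !inE eq_sym.
rewrite /= inE => /orP[/IH yB|/nbhdP[z /IH zB zy]].
  by rewrite inE yB.
rewrite -[_ :|: _]/(gball (1 + r) y); apply: gball_trans zB.
by apply: (@gball_step 0 y y); rewrite ?inE // se.
Qed.

Lemma path_gball x p : path e x p -> {subset x :: p <= gball (size p) x}.
Proof.
elim: p x => [|y p IH] x /=; first by move=> _ z; rewrite !inE.
move=> /andP[xy /IH yp] z; rewrite inE => /orP[/eqP->|/yp zB].
  exact: (gball_center (size p).+1).
rewrite -[_ :|: _]/(gball (1 + size p) x); apply: gball_trans zB.
by apply: (@gball_step 0 x x); rewrite ?inE.
Qed.

Lemma walksP m x p : p \in walks m x -> path e x p /\ size p = m.
Proof.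
elim: m x p => [|m IH] x p /=; first by rewrite inE => /eqP->.
move=> /flatten_mapP[y]; rewrite mem_enum => xy /mapP[q /IH[yq <-] ->] /=.
by rewrite yq andbT.
Qed.

Lemma grown_sets_mono i j x : i <= j -> {subset grown_sets i x <= grown_sets j x}.
Proof.
move=> /subnKC <-; elim: (j - i) => [|k IH] B; first by rewrite addn0.
by move=> /IH SG; rewrite addnS /= mem_cat SG.
Qed.

(** Induction on the last step of the path: its end is either already visited, and the set is
    unchanged, or a new neighbour of the previous end, and the set grows once. The index therefore
    counts distinct vertices, not steps. *)
Lemma grown_sets_path x p :
  path e x p -> visited x p \in grown_sets #|visited x p|.-1 x.
Proof.
elim/last_ind: p => [|p z IH].
  move=> _; have -> : visited x [::] = [set x] by apply/finset.setP => z; rewrite !inE.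
  by rewrite cards1 /= inE.
rewrite rcons_path => /andP[/IH pG pz].
have -> : visited x (rcons p z) = z |: visited x p.
  by apply/finset.setP => w; rewrite !inE mem_rcons inE; case: (w == x); case: (w == z).
have [zp|zp] := boolP (z \in visited x p).
  by rewrite (finset.setUidPr _) // finset.sub1set.
have xp : 0 < #|visited x p| by apply/card_gt0P; exists x; rewrite !inE eqxx.
rewrite cardsU1 zp add1n /= -(prednK xp) /= mem_cat; apply/orP; right.
apply/flatten_mapP; exists (visited x p) => //; apply: map_f.
rewrite mem_enum; apply/nbhdP; exists (last x p) => //.
by rewrite inE mem_last.
Qed.

Lemma grown_setsP i x (B : {set T}) : B \in grown_sets i x ->
  [/\ x \in B, B \subset gball i x & #|B| <= i.+1].
Proof.
elim: i B => [|i IH] B /=.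
  by rewrite inE => /eqP->; rewrite finset.set11 subxx cards1.
rewrite mem_cat => /orP[/IH[xS SB cS]|].
  by rewrite xS (fintype.subset_trans SB (finset.subsetUl _ _)) (leq_trans cS).
move=> /flatten_mapP[B' /IH[xS SB cS] /mapP[z]]; rewrite mem_enum => zS ->.
split; first by rewrite inE xS orbT.
  rewrite finset.subUset (fintype.subset_trans SB (finset.subsetUl _ _)) andbT finset.sub1set.
  case/nbhdP: zS => w wS wz; apply: gball_step wz.
  exact: (fintype.subsetP SB).
by rewrite cardsU1; case: (z \notin B'); rewrite ?add1n ?add0n ?ltnS // ltnW.
Qed.

Variable d : nat.
Hypothesis deg : forall v, #|[pred w | e v w]| <= d.

Lemma card_nbhd (B : {set T}) : #|nbhd B| <= d * #|B|.
Proof.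
have -> : nbhd B = \bigcup_(z in B) [set y | e z y].
  apply/finset.setP => y; apply/nbhdP/bigcupP => -[z zS zy]; exists z => //.
    by rewrite inE.
  by rewrite inE in zy.
rewrite -[#|B|]sum1_card.
apply: (big_ind2 (fun (U : {set T}) m => #|U| <= d * m)) => [|U1 m1 U2 m2 H1 H2|z _].
- by rewrite cards0.
- by rewrite mulnDr (leq_trans (leq_card_setU _ _)) // leq_add.
- by rewrite cardsE muln1; exact: deg.
Qed.

Lemma card_gball r x : #|gball r x| <= d.+1 ^ r.
Proof.
elim: r => [|r IH]; first by rewrite cards1.
rewrite /= (leq_trans (leq_card_setU _ _)) //.
rewrite (leq_trans (leq_add (leqnn _) (card_nbhd _))) //.
by rewrite -mulSn expnS leq_mul2l IH orbT.
Qed.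

(** Before each growth step a set has at most [s] vertices, hence at most [s * d] neighbours;
    keeping the set or adding one of them gives the factor [(s * d).+1]. *)
Lemma size_grown_sets i s x : i < s -> size (grown_sets i x) <= (s * d).+1 ^ i.
Proof.
elim: i => [|i IH] //= is_; rewrite size_cat size_flatten /shape -map_comp.
have {}IH := IH (ltnW is_).
rewrite expnS mulSn leq_add //.
rewrite (@leq_trans (s * d * size (grown_sets i x))) ?leq_mul2l ?IH ?orbT //.
have : {in grown_sets i x, forall B, #|nbhd B| <= s * d}.
  move=> B /grown_setsP[_ _ cS]; rewrite (leq_trans (card_nbhd B)) // mulnC.
  by rewrite leq_mul2r (leq_trans cS) ?orbT // ltnW.
elim: (grown_sets i x) => [|B l IHl] //= H; rewrite mulnS leq_add //.
  by rewrite size_map -cardE H ?mem_head.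
by apply: IHl => U Ul; apply: H; rewrite inE Ul orbT.
Qed.
End Walks.

(** Greedy choice: by double counting, some vertex lies in a proportion at least [s / #|T|] of the
    sets not yet hit, and adding it leaves a proportion at most [1 - s / #|T|] of them. Denominators
    are cleared to stay in [nat]. *)
Lemma hitting_set (T : finType) (L : seq {set T}) (s q : nat) :
  {in L, forall B : {set T}, s <= #|B|} ->
  exists2 X : {set T}, #|X| <= q &
    count (fun B : {set T} => [disjoint B & X]) L * #|T| ^ q <= (#|T| - s) ^ q * size L.
Proof.
move=> Ls; elim: q => [|q [X Xq IH]].
  exists finset.set0; rewrite ?cards0 // !expn0 muln1 mul1n; exact: count_size.
have [T0|/card_gt0P[v0 _]] := posnP #|T|.
  by exists finset.set0; rewrite ?cards0 // T0 exp0n // muln0.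
pose L' := [seq B : {set T} <- L | [disjoint B & X]].
pose c v := count (fun B : {set T} => v \in B) L'.
have sumc : \sum_v c v = \sum_(B <- L') #|B|.
  rewrite /c; under eq_bigr do rewrite -sum1_count big_mkcond /=.
  rewrite exchange_big; apply: eq_bigr => B _.
  by rewrite -big_mkcond sum1_card.
have sc : s * size L' <= \sum_v c v.
  rewrite sumc -sum1_size big_distrr /= !(big_seq_cond xpredT) leq_sum // => B.
  by rewrite muln1 andbT mem_filter => /andP[_ /Ls].
have [v vc] : exists v, s * size L' <= #|T| * c v.
  exists [arg max_(v > v0) c v]; case: arg_maxnP => // v _ vmax.
  apply: leq_trans sc _; rewrite -sum_nat_const; apply: leq_sum => i _.
  exact: vmax.
exists (v |: X).
  by rewrite cardsU1; case: (v \notin X); rewrite ?add1n ?add0n // ltnW.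
have E : count (fun B : {set T} => [disjoint B & v |: X]) L + c v = size L'.
  rewrite /c count_filter size_filter; elim: (L) => //= B l IHl.
  rewrite finset.disjoints_subset finset.setCU finset.subsetI.
  rewrite -!finset.disjoints_subset disjoint_sym finset.disjoints1.
  rewrite addnACA IHl.
  by case: (v \in B); case: [disjoint B & X].
have {}IH : size L' * #|T| ^ q <= (#|T| - s) ^ q * size L.
  by rewrite size_filter.
set b := count _ _ in E *.
have bL : b * #|T| <= (#|T| - s) * size L'.
  by rewrite mulnBl; nia.
rewrite expnS mulnA (leq_trans (leq_mul bL (leqnn _))) // -mulnA expnS -mulnA.
by rewrite leq_mul2l IH orbT.
Qed.

Local Open Scope ring_scope.

(** * Spectral theorem and interlacing *)

Section Spectral.
Variable R : rcfType.

Definition dot n (u v : 'rV[R]_n) : R := (u *m v^T) 0 0.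
Definition sqn n (v : 'rV[R]_n) : R := dot v v.
Definition qform n (A : 'M[R]_n) (v : 'rV[R]_n) : R := dot (v *m A) v.

Lemma dotE n (u v : 'rV[R]_n) : dot u v = \sum_i u 0 i * v 0 i.
Proof. by rewrite /dot mxE; apply: eq_bigr => i _; rewrite mxE. Qed.

Lemma dotC n (u v : 'rV[R]_n) : dot u v = dot v u.
Proof. by rewrite !dotE; apply: eq_bigr => i _; rewrite mulrC. Qed.

Lemma dotDl n (u v w : 'rV[R]_n) : dot (u + v) w = dot u w + dot v w.
Proof. by rewrite /dot mulmxDl mxE. Qed.

Lemma dotZl n a (u w : 'rV[R]_n) : dot (a *: u) w = a * dot u w.
Proof. by rewrite /dot -scalemxAl mxE. Qed.

Lemma dotBl n (u v w : 'rV[R]_n) : dot (u - v) w = dot u w - dot v w.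
Proof. by rewrite -scaleN1r dotDl dotZl mulN1r. Qed.

Lemma dotDr n (u v w : 'rV[R]_n) : dot w (u + v) = dot w u + dot w v.
Proof. by rewrite dotC dotDl !(dotC w). Qed.

Lemma dotZr n a (u w : 'rV[R]_n) : dot w (a *: u) = a * dot w u.
Proof. by rewrite dotC dotZl (dotC w). Qed.

Lemma dotBr n (u v w : 'rV[R]_n) : dot w (u - v) = dot w u - dot w v.
Proof. by rewrite dotC dotBl !(dotC w). Qed.

Lemma dot_mulmx n (A : 'M[R]_n) (u v : 'rV[R]_n) :
  dot (u *m A) v = dot u (v *m A^T).
Proof. by rewrite /dot trmx_mul trmxK mulmxA. Qed.

Lemma sqnE n (v : 'rV[R]_n) : sqn v = \sum_i v 0 i ^+ 2.
Proof. by rewrite /sqn dotE. Qed.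

Lemma sqn_ge0 n (v : 'rV[R]_n) : 0 <= sqn v.
Proof. by rewrite sqnE sumr_ge0 // => i _; rewrite sqr_ge0. Qed.

Lemma sqn_eq0 n (v : 'rV[R]_n) : (sqn v == 0) = (v == 0).
Proof.
rewrite sqnE psumr_eq0; last by move=> i _; rewrite sqr_ge0.
apply/allP/eqP => [v0|-> i _]; last by rewrite mxE expr0n eqxx.
apply/rowP => i; rewrite mxE; apply/eqP.
by rewrite -sqrf_eq0; apply: v0; rewrite mem_index_enum.
Qed.

(** Take a complex eigenvector [a + i b] for the eigenvalue [z]. Comparing [dot (a *m A) b] with
    [dot (b *m A) a], which symmetry makes equal, gives [Im z * (sqn a + sqn b) = 0]; so [z] is real
    and whichever of [a], [b] is nonzero is a real eigenvector. *)
Lemma sym_eigenvector n (A : 'M[R]_n.+1) : A^T = A ->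
  exists (l : R) (v : 'rV[R]_n.+1), v != 0 /\ v *m A = l *: v.
Proof.
move=> symA.
have [z /eigenvalueP[x xA x0]] :=
  eigenvalue_closed (map_mx (real_complex R) A) (ltn0Sn n).
pose a : 'rV[R]_n.+1 := map_mx (@complex.Re R) x.
pose b : 'rV[R]_n.+1 := map_mx (@complex.Im R) x.
have ReM (u w : R[i]) : complex.Re (u * w) =
    complex.Re u * complex.Re w - complex.Im u * complex.Im w.
  by case: u; case: w.
have ImM (u w : R[i]) : complex.Im (u * w) =
    complex.Re u * complex.Im w + complex.Im u * complex.Re w.
  by case: u; case: w.
have aA : a *m A = complex.Re z *: a - complex.Im z *: b.
  apply/rowP => j; move/rowP/(_ j)/(congr1 (@complex.Re R)): xA.
  rewrite !mxE raddf_sum /= ReM => <-; apply: eq_bigr => i _.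
  by rewrite !mxE ReM /= mulr0 subr0.
have bA : b *m A = complex.Re z *: b + complex.Im z *: a.
  apply/rowP => j; move/rowP/(_ j)/(congr1 (@complex.Im R)): xA.
  rewrite !mxE raddf_sum /= ImM => <-; apply: eq_bigr => i _.
  by rewrite !mxE ImM /= mulr0 add0r.
have ab0 : (a != 0) || (b != 0).
  rewrite -negb_and; apply: contra x0 => /andP[/eqP a0 /eqP b0].
  apply/eqP/rowP => j; move/rowP/(_ j): a0; move/rowP/(_ j): b0.
  by rewrite !mxE; case: (x 0 j) => /= ? ? -> ->.
have Im0 : complex.Im z = 0.
  have E : dot (a *m A) b = dot (b *m A) a by rewrite dot_mulmx symA dotC.
  rewrite aA bA dotBl dotDl !dotZl (dotC b a) in E.
  have /eqP : complex.Im z * (sqn a + sqn b) = 0.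
    by rewrite /sqn; move: E; lra.
  rewrite mulf_eq0 => /orP[/eqP //|].
  rewrite paddr_eq0 ?sqn_ge0// !sqn_eq0 => /andP[a0 b0].
  by rewrite a0 b0 in ab0.
exists (complex.Re z); case/orP: ab0 => [a0|b0]; [exists a|exists b]; split => //.
  by rewrite aA Im0 scale0r subr0.
by rewrite bA Im0 scale0r addr0.
Qed.

(** The reflection in the hyperplane orthogonal to [w - e] exchanges [w] and the first basis vector
    [e]; it degenerates when [w = e], where the identity serves. *)
Lemma householder n (w : 'rV[R]_n.+1) : sqn w = 1 ->
  exists H : 'M[R]_n.+1, H *m H^T = 1%:M /\ row 0 H = w.
Proof.
move=> w1; pose e : 'rV[R]_n.+1 := delta_mx 0 0.
have e1 : sqn e = 1 by rewrite /sqn /dot trmx_delta mul_delta_mx mxE eqxx.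
have [we|we] := eqVneq w e.
  by exists 1%:M; rewrite trmx1 mulmx1 row1 we.
pose u := w - e.
have u0 : sqn u != 0 by rewrite sqn_eq0 subr_eq0.
pose c := 2 / sqn u.
pose H := 1%:M - c *: (u^T *m u).
have Hsym : H^T = H.
  by rewrite /H linearB /= trmx1 linearZ /= trmx_mul trmxK.
pose P := u^T *m u; have PP : P *m P = sqn u *: P.
  by rewrite /P mulmxA -[u^T *m u *m u^T]mulmxA [u *m u^T]mx11_scalar
     mul_mx_scalar -scalemxAl.
have cu : c * sqn u = 2 by rewrite /c divfK.
exists H; split.
  rewrite Hsym /H -/P mulmxBl mul1mx mulmxBr mulmx1 -scalemxAl -scalemxAr PP.
  rewrite !scalerA -mulrA cu; apply/matrixP => i j; rewrite !mxE; ring.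
have dot_e (x : 'rV[R]_n.+1) : dot x e = x 0 0.
  by rewrite /dot trmx_delta -colE mxE.
have sqnu : sqn u = 2 - 2 * w 0 0.
  rewrite /sqn /u dotBl !dotBr (dotC e w) dot_e -/(sqn w) -/(sqn e) w1 e1.
  by ring.
have u00 : u 0 0 = w 0 0 - 1 by rewrite !mxE eqxx.
rewrite rowE -/e /H mulmxBr mulmx1 -scalemxAr mulmxA.
rewrite [e *m u^T]mx11_scalar -/(dot e u) dotC dot_e u00.
rewrite mul_scalar_mx scalerA (_ : c * _ = -1); last first.
  by rewrite /c sqnu; field; rewrite -sqnu.
by rewrite scaleN1r opprK /u addrC subrK.
Qed.

(** Deflation: conjugating by an orthogonal matrix whose first row is a unit eigenvector leaves a
    block diagonal matrix, and the induction hypothesis diagonalizes the lower symmetric block. *)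
Lemma sym_spectral n (A : 'M[R]_n) : A^T = A ->
  exists (P : 'M[R]_n) (D : 'rV[R]_n),
    P *m P^T = 1%:M /\ A = P^T *m diag_mx D *m P.
Proof.
elim: n A => [|n IH] A symA.
  by exists 1%:M, 0; rewrite !(flatmx0 _, thinmx0).
have [l [v [v0 vA]]] := sym_eigenvector symA.
pose w := (Num.sqrt (sqn v))^-1 *: v.
have sv : 0 < sqn v by rewrite lt_def sqn_eq0 v0 sqn_ge0.
have w1 : sqn w = 1.
  rewrite /sqn dotZl dotZr mulrA -/(sqn v).
  by rewrite -invfM -expr2 sqr_sqrtr ?ltW// mulVf ?gt_eqF.
have wA : w *m A = l *: w.
  by rewrite /w -scalemxAl vA !scalerA mulrC.
have [H [HH rH]] := householder w1.
have HtH : H^T *m H = 1%:M by apply: mulmx1C.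
(* The size is written [1 + n] so that the block operations apply. *)
pose M : 'M[R]_(1 + n) := H *m A *m H^T.
have symM : M^T = M by rewrite /M !trmx_mul trmxK symA mulmxA.
have rM : row 0 M = l *: delta_mx 0 0.
  rewrite /M row_mul row_mul rH wA -scalemxAl -rH -row_mul HH.
  by rewrite row1.
have ME : M = H *m A *m H^T by [].
clearbody M.
have ulM : ulsubmx M = l%:M.
  rewrite [LHS]mx11_scalar !mxE; congr (_%:M).
  move/rowP/(_ 0): rM; rewrite !mxE eqxx mulr1 => <-.
  by congr (M _ _); apply/val_inj.
have urM : ursubmx M = 0.
  apply/matrixP => i j; move/rowP/(_ (rshift 1 j)): rM; rewrite !mxE.
  rewrite mulr0 => <-; congr (M _ _); apply/val_inj => /=.
  by case: i => [[|]].
have dlM : dlsubmx M = 0 by rewrite -[M]symM -trmx_ursub urM trmx0.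
have [] := IH (drsubmx M); first by rewrite trmx_drsub symM.
move=> P' [D' [PP' MD]].
have PM : M = block_mx l%:M 0 0 (P'^T *m diag_mx D' *m P').
  by rewrite -[M]submxK ulM urM dlM MD.
pose Q : 'M[R]_(1 + n) := block_mx 1%:M 0 0 P'.
have QT : Q^T = block_mx 1%:M 0 0 P'^T.
  by rewrite [LHS](@tr_block_mx _ 1 n 1 n) !trmx0 trmx1.
exists (Q *m H), (row_mx l%:M D' : 'rV_(1 + n)); split.
  rewrite trmx_mul mulmxA -[Q *m H *m H^T]mulmxA HH mulmx1.
  rewrite QT (@mulmx_block _ 1 n 1 n 1 n) !mulmx0 !mul0mx !mulmx1.
  by rewrite !addr0 !add0r PP' -(@scalar_mx_block _ 1 n).
have -> : A = H^T *m M *m H.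
  by rewrite ME !mulmxA HtH mul1mx -mulmxA HtH mulmx1.
rewrite trmx_mul -!mulmxA; congr (_ *m _); rewrite !mulmxA; congr (_ *m _).
rewrite PM QT (@diag_mx_row _ n 1) !(@mulmx_block _ 1 n 1 n 1 n).
rewrite !mulmx0 !mul0mx !mul1mx !mulmx1 !addr0 !add0r.
have -> : diag_mx l%:M = l%:M :> 'M[R]_1.
  by apply/matrixP => i j; rewrite !ord1 !mxE eqxx.
by rewrite mul0mx.
Qed.
End Spectral.

Lemma mup_prod_XsubC (F : fieldType) (s : seq F) (x : F) :
  mup x (\prod_(a <- s) ('X - a%:P)) = count_mem x s.
Proof.
elim: s => [|a s IH]; first by rewrite big_nil mupNroot // rootC oner_eq0.
rewrite big_cons mupM ?polyXsubC_eq0 ?monic_neq0 ?monic_prod_XsubC // IH /=.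
by rewrite -[_ - _]expr1 mup_XsubCX /=; case: eqVneq.
Qed.

Lemma count_mem_flatten_nseq (T : eqType) (f : T -> nat) (r : seq T) (x : T) :
  uniq r ->
  count_mem x (flatten [seq nseq (f y) y | y <- r]) = ((x \in r) * f x)%N.
Proof.
elim: r => //= y r IH /andP[yr ur]; rewrite count_cat IH // count_nseq inE /=.
case: (eqVneq y x) yr => [-> /negPf->|]; first by rewrite /= addn0.
by [].
Qed.

(** * Counting eigenvalues: min-max and interlacing *)

Section Eigenvalues.
Variable R : realType.

Lemma char_poly_spectral n (A P : 'M[R]_n) (D : 'rV[R]_n) :
  P *m P^T = 1%:M -> A = P^T *m diag_mx D *m P ->
  char_poly A = \prod_(i < n) ('X - (D 0 i)%:P).
Proof.
move=> PP AD; have PtP := mulmx1C PP.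
pose Q := map_mx (@polyC R) P.
have QQ : Q^T *m Q = 1%:M.
  by rewrite /Q map_trmx -map_mxM PtP map_mx1.
have -> : char_poly A = char_poly (diag_mx D).
  have E : char_poly_mx A = Q^T *m char_poly_mx (diag_mx D) *m Q.
    rewrite /char_poly_mx mulmxBr mulmxBl mul_mx_scalar -scalemxAl QQ.
    rewrite AD !map_mxM -map_trmx -/Q.
    by rewrite scalemx1.
  rewrite /char_poly E !det_mulmx mulrAC -det_mulmx QQ.
  by rewrite det1 mul1r.
rewrite char_poly_trig ?diag_mx_is_trig //.
by apply: eq_bigr => i _; rewrite mxE eqxx.
Qed.

(** Both lists repeat each real as often as its multiplicity as a root of the characteristic
    polynomial. This lets every later count be made on the diagonal [D]. *)
Lemma eigenvalues_spectral n (A P : 'M[R]_n) (D : 'rV[R]_n) :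
  P *m P^T = 1%:M -> A = P^T *m diag_mx D *m P ->
  perm_eq (eigenvalues A) [seq D 0 i | i <- enum 'I_n].
Proof.
move=> PP AD; rewrite /eigenvalues perm_sort.
have pE : char_poly A = \prod_(a <- [seq D 0 i | i <- enum 'I_n]) ('X - a%:P).
  by rewrite (char_poly_spectral PP AD) big_map big_enum.
have p0 : char_poly A != 0 by rewrite monic_neq0 ?char_poly_monic.
apply/allP => x _ /=; apply/eqP; rewrite count_mem_flatten_nseq ?uniq_roots //.
rewrite -mup_prod_XsubC -pE; have := roots_on_rootsR p0 x; rewrite in_itv /= => <-.
by case rx: (root _ x); rewrite ?mul1n // mupNroot ?rx.
Qed.

Lemma size_eigenvalues n (A : 'M[R]_n) : A^T = A -> size (eigenvalues A) = n.
Proof.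
move=> /sym_spectral[P [D [PP /(eigenvalues_spectral PP)/perm_size->]]].
by rewrite size_map size_enum_ord.
Qed.

Lemma sqn_spectral n (P : 'M[R]_n) (v : 'rV[R]_n) :
  P *m P^T = 1%:M -> sqn v = sqn (v *m P^T).
Proof.
by move=> /mulmx1C PP; rewrite /sqn dot_mulmx trmxK -mulmxA PP mulmx1.
Qed.

Lemma qform_spectral n (A P : 'M[R]_n) (D : 'rV[R]_n) (v : 'rV[R]_n) :
  A = P^T *m diag_mx D *m P ->
  qform A v = \sum_i D 0 i * (v *m P^T) 0 i ^+ 2.
Proof.
move=> ->; rewrite /qform !mulmxA dot_mulmx dotE.
by apply: eq_bigr => i _; rewrite mul_mx_diag mxE expr2 mulrA (mulrC (D 0 i)).
Qed.

Lemma trmx_spectral n (A P : 'M[R]_n) (D : 'rV[R]_n) (k : nat) :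
  P *m P^T = 1%:M -> A = P^T *m diag_mx D *m P ->
  \tr (A ^+ k) = \sum_i D 0 i ^+ k.
Proof.
move=> PP AD.
have -> : A ^+ k = P^T *m diag_mx (\row_i D 0 i ^+ k) *m P.
  elim: k => [|k IH].
    rewrite expr0 (_ : diag_mx _ = 1%:M) ?mulmx1 ?(mulmx1C PP) //.
    by apply/matrixP => i j; rewrite !mxE expr0.
  rewrite exprSr IH -mulmxE AD !mulmxA -[_ *m P *m P^T]mulmxA PP mulmx1.
  rewrite -[P^T *m _ *m _]mulmxA mulmx_diag; congr (_ *m diag_mx _ *m _).
  by apply/rowP => i; rewrite !mxE exprSr.
rewrite mxtrace_mulC mulmxA PP mul1mx mxtrace_diag.
by apply: eq_bigr => i _; rewrite mxE.
Qed.

Lemma mxtrace_eigenvalues n (A : 'M[R]_n) (k : nat) : A^T = A ->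
  \tr (A ^+ k) = \sum_(x <- eigenvalues A) x ^+ k.
Proof.
move=> /sym_spectral[P [D [PP AD]]]; rewrite (trmx_spectral k PP AD).
by rewrite (perm_big _ (eigenvalues_spectral PP AD)) big_map big_enum.
Qed.

Lemma count_eigenvalues n (A P : 'M[R]_n) (D : 'rV[R]_n) (p : pred R) :
  P *m P^T = 1%:M -> A = P^T *m diag_mx D *m P ->
  count p (eigenvalues A) = #|[pred i | p (D 0 i)]|.
Proof.
move=> PP AD; have /permP-> := eigenvalues_spectral PP AD.
by rewrite count_map -sum1_count big_enum_cond -sum1_card; apply: eq_bigl.
Qed.

Lemma rank_rowsub_orthonormal n (P : 'M[R]_n) m (f : 'I_m -> 'I_n) :
  injective f -> P *m P^T = 1%:M -> \rank (rowsub f P) = m.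
Proof.
move=> fI PP; apply/eqP/row_freeP; exists (rowsub f P)^T.
apply/matrixP => i j; move/matrixP/(_ (f i) (f j)): PP.
rewrite !mxE (inj_eq fI) => <-; apply: eq_bigr => k _; by rewrite !mxE.
Qed.

Lemma rowsub_coord n (P : 'M[R]_n) (p : pred 'I_n) (v : 'rV[R]_n) (i : 'I_n) :
  P *m P^T = 1%:M -> (v <= rowsub (@enum_val _ p) P)%MS -> ~~ p i ->
  (v *m P^T) 0 i = 0.
Proof.
move=> PP /submxP[c ->] pi.
have -> : c *m rowsub enum_val P *m P^T = c *m rowsub enum_val 1%:M.
  by rewrite -mulmxA mul_rowsub_mx PP.
rewrite mxE big1 // => j _; rewrite !mxE (_ : (_ == i) = false) ?mulr0 //.
by apply: contraNF pi => /eqP <-; exact: (enum_valP j).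
Qed.

(** One half of the min-max principle. Were the rank larger, [U] would meet the span [W] of the
    eigenvectors with eigenvalue below [t] in a nonzero vector, on which the form is strictly less
    than [t * sqn v]. *)
Lemma rank_le_count_eigenvalues n (A : 'M[R]_n) r (U : 'M[R]_(r, n)) (t : R) :
  A^T = A ->
  (forall v : 'rV_n, (v <= U)%MS -> t * sqn v <= qform A v) ->
  (\rank U <= count (fun x => t <= x)%R (eigenvalues A))%N.
Proof.
move=> /sym_spectral[P [D [PP AD]]] Ut.
rewrite (count_eigenvalues _ PP AD).
set p : pred 'I_n := [pred i | t <= D 0 i].
pose W := rowsub (@enum_val _ (predC p)) P.
have rW : \rank W = #|predC p| by apply: rank_rowsub_orthonormal => //; exact: enum_val_inj.
rewrite leqNgt; apply/negP => pU.
have : (U :&: W)%MS != 0.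
  rewrite -mxrank_eq0 -lt0n; have := mxrank_sum_cap U W.
  have := rank_leq_col (U + W)%MS.
  have {}pU : (#|p| < \rank U)%N := pU.
  have pC : (#|p| + #|predC p| = n)%N by have := cardC p; rewrite card_ord.
  by rewrite rW; move: pU pC; lia.
rewrite -nz_row_eq0; set v := nz_row _ => v0.
have /[!sub_capmx]/andP[vU vW] : (v <= U :&: W)%MS by apply: nz_row_sub.
have yp i : p i -> (v *m P^T) 0 i = 0.
  by move=> pi; apply: (rowsub_coord PP vW); rewrite /= negbK.
have := Ut _ vU; rewrite (qform_spectral _ AD) (sqn_spectral v PP) sqnE mulr_sumr.
rewrite -subr_ge0 -sumrB -oppr_le0 -sumrN => S0.
(* These nonnegative terms have a nonpositive sum, so all vanish; since [D 0 i < t] off [p], every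
   coordinate of [v] is then zero. *)
have F0 i : 0 <= - (D 0 i * (v *m P^T) 0 i ^+ 2 - t * (v *m P^T) 0 i ^+ 2).
  have [pi|pi] := boolP (p i); first by rewrite yp // expr0n /= !mulr0 subr0 oppr0.
  rewrite -mulrBl -mulNr mulr_ge0 ?sqr_ge0 // opprB subr_ge0.
  by rewrite ltW // ltNge.
have /eqP : \sum_i - (D 0 i * (v *m P^T) 0 i ^+ 2 - t * (v *m P^T) 0 i ^+ 2) = 0.
  by apply/eqP; rewrite eq_le S0 sumr_ge0.
rewrite psumr_eq0 // => /allP y0.
suff y00 : v *m P^T = 0.
  by move: v0; rewrite -sqn_eq0 (sqn_spectral v PP) y00 sqn_eq0 eqxx.
apply/rowP => i; rewrite [RHS]mxE; have [/yp//|pi] := boolP (p i).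
have := y0 i (mem_index_enum _); rewrite /= -mulrBl oppr_eq0 mulf_eq0 subr_eq0.
rewrite sqrf_eq0 => /orP[/eqP Dt|/eqP//].
by move: pi; rewrite /p /= Dt lexx.
Qed.

Lemma span_eigenvectors n (A : 'M[R]_n) (t : R) : A^T = A ->
  exists r (U : 'M[R]_(r, n)),
    \rank U = count (fun x => t <= x)%R (eigenvalues A) /\
    (forall v : 'rV_n, (v <= U)%MS -> t * sqn v <= qform A v).
Proof.
move=> /sym_spectral[P [D [PP AD]]].
set p : pred 'I_n := [pred i | t <= D 0 i].
exists #|p|, (rowsub (@enum_val _ p) P); split.
  rewrite (count_eigenvalues _ PP AD).
  by apply: rank_rowsub_orthonormal => //; exact: enum_val_inj.
move=> v vU; rewrite (qform_spectral _ AD) (sqn_spectral v PP) sqnE mulr_sumr.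
apply: ler_sum => i _; have [pi|pi] := boolP (p i).
  by rewrite ler_wpM2r ?sqr_ge0.
by rewrite (rowsub_coord PP vU pi) expr0n /= !mulr0.
Qed.

(** Intersect the span [U] of the eigenvectors of [A] at or above [t] with the space [K] of vectors
    vanishing on [X]. This loses at most [#|X|] dimensions, and on the intersection the two forms
    agree, so min-max applies to [B]. *)
Lemma interlacing n (A B : 'M[R]_n) (X : {set 'I_n}) (t : R) :
  A^T = A -> B^T = B ->
  (forall i j, i \notin X -> j \notin X -> B i j = A i j) ->
  (count (fun x => t <= x)%R (eigenvalues A) <=
   #|X| + count (fun x => t <= x)%R (eigenvalues B))%N.
Proof.
move=> sA sB AB; have [r [U [rU Ut]]] := span_eigenvectors t sA.
pose p : pred 'I_n := [pred i | i \notin X].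
pose K : 'M[R]_(_, n) := rowsub (@enum_val _ p) 1%:M.
have I1 : 1%:M *m 1%:M^T = 1%:M :> 'M[R]_n by rewrite trmx1 mulmx1.
have rK : \rank K = #|p| by apply: rank_rowsub_orthonormal => //; exact: enum_val_inj.
have : (\rank (U :&: K)%MS <= count (fun x => t <= x)%R (eigenvalues B))%N.
  apply: rank_le_count_eigenvalues => // v; rewrite sub_capmx => /andP[vU vK].
  have v0 i : i \in X -> v 0 i = 0.
    move=> iX; have := @rowsub_coord _ _ p v i I1 vK.
    by rewrite trmx1 mulmx1; apply; rewrite /p /= iX.
  rewrite (le_trans (Ut _ vU)) // le_eqVlt; apply/orP; left; apply/eqP.
  rewrite /qform !dotE; apply: eq_bigr => j _.
  have [jX|jX] := boolP (j \in X); first by rewrite v0 // !mulr0.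
  rewrite !mxE; congr (_ * _); apply: eq_bigr => i _.
  by have [iX|iX] := boolP (i \in X); [rewrite v0 // !mul0r|rewrite AB].
have := mxrank_sum_cap U K; have := rank_leq_col (U + K)%MS.
have : (#|p| + #|X| = n)%N.
  rewrite -[RHS]card_ord addnC -(cardC [in X]); congr (_ + _)%N.
rewrite rU rK; set c1 := count _ _; set c2 := count _ _; lia.
Qed.

Lemma second_eigenvalue_ge n (A : 'M[R]_n) (t : R) : 
  (2 <= count (fun x => t <= x)%R (eigenvalues A))%N -> t <= lambda A 2.
Proof.
rewrite /lambda /=; have : sorted >=%R (eigenvalues A).
  by apply: sort_sorted => x y; exact: ge_total.
case: (eigenvalues A) => [|a [|b s]] //=; first by case: (t <= a).
move=> /andP[_ bs] c2; rewrite leNgt; apply/negP => bt.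
move: c2; rewrite leqNgt => /negP; apply.
rewrite [X in (_ + (X + _))%N](_ : _ = 0)%N ?[X in (_ + (_ + X))%N](_ : _ = 0)%N.
- by case: (t <= a).
- apply/eqP; rewrite -leqn0 leqNgt -has_count; apply/hasPn => x xs.
  rewrite -ltNge; apply: le_lt_trans bt.
  have /allP/(_ x xs) := order_path_min (rev_trans (@le_trans _ R)) bs.
  by [].
- by rewrite leNgt bt.
Qed.
End Eigenvalues.

(** * Quadratic forms on induced subgraphs *)

Section Forms.
Variable R : realType.

Lemma qformE n (M : 'M[R]_n) (v : 'rV[R]_n) :
  qform M v = \sum_j \sum_i v 0 i * M i j * v 0 j.
Proof.
rewrite /qform dotE; apply: eq_bigr => j _; rewrite mxE mulr_suml.
by apply: eq_bigr.
Qed.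

Lemma qformD n (M : 'M[R]_n) (u v : 'rV[R]_n) : M^T = M ->
  qform M (u + v) = qform M u + 2 * dot (u *m M) v + qform M v.
Proof.
move=> sM; rewrite /qform mulmxDl dotDl !dotDr.
have -> : dot (v *m M) u = dot (u *m M) v by rewrite dot_mulmx sM dotC.
by ring.
Qed.

Lemma qformZ n (M : 'M[R]_n) a (v : 'rV[R]_n) :
  qform M (a *: v) = a ^+ 2 * qform M v.
Proof. by rewrite /qform -scalemxAl dotZl dotZr mulrA. Qed.

Lemma sqnD n (u v : 'rV[R]_n) : sqn (u + v) = sqn u + 2 * dot u v + sqn v.
Proof. by rewrite /sqn dotDl !dotDr (dotC v u); ring. Qed.

Lemma sqnZ n a (v : 'rV[R]_n) : sqn (a *: v) = a ^+ 2 * sqn v.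
Proof. by rewrite /sqn dotZl dotZr mulrA. Qed.

(** Passes from the numerical radius to the operator norm, so that form bounds can be iterated along
    powers of [M]. *)
Lemma sqn_mulmx_le n (M : 'M[R]_n) (mu : R) : M^T = M -> 0 < mu ->
  (forall v, `|qform M v| <= mu * sqn v) ->
  forall v, sqn (v *m M) <= mu ^+ 2 * sqn v.
Proof.
move=> sM mu0 Mmu v.
(* Polarization, applied below with [w = mu^-1 v M]. *)
have pol w : 4 * dot (v *m M) w <= mu * (sqn (v + w) + sqn (v - w)).
  have -> : 4 * dot (v *m M) w = qform M (v + w) - qform M (v - w).
    rewrite -(scaleN1r w) !(qformD _ _ sM) qformZ dotZr; ring.
  rewrite mulrDr lerD //; first exact: le_trans (ler_norm _) (Mmu _).
  by rewrite (le_trans _ (Mmu _)) // -normrN ler_norm.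
have := pol (mu^-1 *: (v *m M)).
rewrite -(scaleN1r (_ *: _)) !sqnD !sqnZ !dotZr -/(sqn (v *m M)).
have -> : mu * (sqn v + 2 * (mu^-1 * dot v (v *m M)) + mu^-1 ^+ 2 * sqn (v *m M) +
   (sqn v + 2 * (-1 * (mu^-1 * dot v (v *m M))) +
     (-1) ^+ 2 * (mu^-1 ^+ 2 * sqn (v *m M)))) =
   2 * mu * sqn v + 2 * mu^-1 * sqn (v *m M).
  by field; rewrite gt_eqF.
rewrite /sqn => H; have {}H : mu^-1 * dot (v *m M) (v *m M) <= mu * dot v v by lra.
by rewrite expr2 -mulrA -ler_pdivrMl.
Qed.

(** By symmetry a diagonal entry of an even power is the squared norm of [e *m M ^+ k], and each
    factor [M] stretches norms by at most [mu]. *)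
Lemma exprmx_diag_le n (M : 'M[R]_n) (mu : R) (k : nat) (x : 'I_n) :
  M^T = M -> 0 < mu -> (forall v, `|qform M v| <= mu * sqn v) ->
  (M ^+ k.*2) x x <= mu ^+ k.*2.
Proof.
move=> sM mu0 Mmu; pose e : 'rV[R]_n := delta_mx 0 x.
have sMk : (M ^+ k)^T = M ^+ k.
  elim: (k) => [|j IH]; first by rewrite expr0 trmx1.
  by rewrite exprS -mulmxE trmx_mul IH sM mulmxE -exprSr exprS.
have -> : (M ^+ k.*2) x x = sqn (e *m M ^+ k).
  rewrite /sqn dot_mulmx dotC -mulmxA sMk mulmxE -exprD addnn -rowE.
  by rewrite /dot trmx_delta -colE !mxE.
rewrite -mul2n exprM.
elim: k {sMk} => [|k IH].
  by rewrite !expr0 mulmx1 /sqn /dot trmx_delta mul_delta_mx mxE eqxx.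
rewrite exprSr -mulmxE mulmxA (le_trans (sqn_mulmx_le sM mu0 Mmu _)) //.
by rewrite [X in _ <= X]exprS ler_wpM2l ?sqr_ge0.
Qed.

(** Both cross terms vanish, so the Rayleigh bound extends from [v] and [w] to the plane they span,
    and min-max yields two eigenvalues at least [t]. *)
Lemma second_eigenvalue_ge_forms n (M : 'M[R]_n) (t : R) (v w : 'rV[R]_n) :
  M^T = M -> v != 0 -> w != 0 -> dot v w = 0 -> dot (v *m M) w = 0 ->
  t * sqn v <= qform M v -> t * sqn w <= qform M w -> t <= lambda M 2.
Proof.
move=> sM v0 w0 vw vMw tv tw; apply: second_eigenvalue_ge.
pose U := col_mx v w : 'M[R]_(1 + 1, n).
have rU : \rank U = 2%N.
  apply/eqP; rewrite -[_ == _]/(row_free U); apply/row_freeP.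
  (* Orthogonality makes the rescaled transposes a right inverse. *)
  exists (row_mx ((sqn v)^-1 *: v^T) ((sqn w)^-1 *: w^T)).
  rewrite mul_col_row -!scalemxAr.
  rewrite [v *m v^T]mx11_scalar [w *m w^T]mx11_scalar [v *m w^T]mx11_scalar.
  rewrite [w *m v^T]mx11_scalar -/(dot v v) -/(dot w w) -/(dot v w) -/(dot w v).
  rewrite (dotC w v) vw -/(sqn v) -/(sqn w) !scale_scalar_mx.
  by rewrite !mulr0 !mulVf ?sqn_eq0 // !raddf0 -scalar_mx_block.
rewrite -rU; apply: rank_le_count_eigenvalues => // u /submxP[c ->].
rewrite -[c]hsubmxK mul_row_col [lsubmx c]mx11_scalar [rsubmx c]mx11_scalar.
rewrite !mul_scalar_mx; set a := lsubmx c _ _; set b := rsubmx c _ _.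
rewrite sqnD qformD // !sqnZ !qformZ -scalemxAl !dotZl !dotZr vw vMw !mulr0 !addr0.
by rewrite mulrDr lerD // mulrCA ler_wpM2l ?sqr_ge0.
Qed.
End Forms.

(** * Closed walks and test vectors in a graph *)

Section Graph.
Variables (R : realType) (n : nat) (G : sgraph n).
Local Notation A := (adjmx R G).

(** The induced subgraph keeps the full size [n], with zero rows and columns outside [U], so that it
    can be compared with [A] by [interlacing]. *)
Definition indmx (U : {set 'I_n}) : 'M[R]_n :=
  \matrix_(i, j) [&& i \in U, j \in U & G i j]%:R.

Definition supported (U : {set 'I_n}) (v : 'rV[R]_n) :=
  forall i, i \notin U -> v 0 i = 0.

(** For nonempty [U] this says that the largest adjacency eigenvalue of the subgraph induced on [U]
    is at most [rho]. *)
Definition form_le (U : {set 'I_n}) (rho : R) :=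
  forall v, supported U v -> qform A v <= rho * sqn v.

Lemma adjmx_sym : A^T = A.
Proof. by apply/matrixP => i j; rewrite !mxE adj_sym. Qed.

Lemma indmx_sym U : (indmx U)^T = indmx U.
Proof. by apply/matrixP => i j; rewrite !mxE adj_sym andbCA. Qed.

(** Induction on the first step. The start is not listed in a walk, so its membership in [U] is a
    separate hypothesis. *)
Lemma exprmx_walks (U : {set 'I_n}) m x y : x \in U ->
  (indmx U ^+ m) x y =
  (count (fun p => (last x p == y) && all [in U] p) (walks G m x))%:R.
Proof.
elim: m x => [|m IH] x xU; first by rewrite expr0 !mxE /= andbT addn0.
rewrite exprS -mulmxE mxE /= count_flatten -map_comp sumnE big_map natr_sum.
rewrite big_enum /= [RHS]big_mkcond /=; apply: eq_bigr => z _.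
rewrite mxE xU /= count_map -[z \in G x]/(G x z).
have [xz|xz] := boolP (G x z); last by rewrite andbF mul0r.
rewrite andbT; have [zU|zU] := boolP (z \in U).
  by rewrite mul1r IH //; congr (_%:R); apply: eq_count => p /=; rewrite zU.
rewrite mul0r (eq_count (a2 := pred0)) ?count_pred0 // => p /=.
by rewrite (negPf zU) andbF.
Qed.

(** Since the entries are nonnegative, passing to absolute values only raises the form. This turns
    the one-sided bound [form_le] into the two-sided one required by [exprmx_diag_le]. *)
Lemma qform_norm (v : 'rV[R]_n) (U : {set 'I_n}) :
  `|qform (indmx U) v| <= qform A (\row_i if i \in U then `|v 0 i| else 0).
Proof.
rewrite !qformE (le_trans (ler_norm_sum _ _ _)) //; apply: ler_sum => j _.
rewrite (le_trans (ler_norm_sum _ _ _)) //; apply: ler_sum => i _.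
rewrite !mxE !normrM; case: (i \in U); case: (j \in U) => //=;
  by rewrite ?normr0 ?mulr0 ?mul0r // normr_nat.
Qed.

Lemma sqn_norm_le (v : 'rV[R]_n) (U : {set 'I_n}) :
  sqn (\row_i if i \in U then `|v 0 i| else 0) <= sqn v.
Proof.
rewrite !sqnE; apply: ler_sum => i _; rewrite mxE; case: ifP => _.
  by rewrite real_normK // num_real.
by rewrite expr0n sqr_ge0.
Qed.

Lemma closed_walks_le (U : {set 'I_n}) rho k x : form_le U rho -> 0 < rho -> x \in U ->
  (count (fun p => (last x p == x) && all [in U] p) (walks G k.*2 x))%:R
    <= rho ^+ k.*2.
Proof.
move=> Ur rho0 xU; rewrite -exprmx_walks //.
apply: exprmx_diag_le => //; first exact: indmx_sym.
move=> v; rewrite (le_trans (qform_norm _ _)) //.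
rewrite (le_trans (Ur _ _)) ?ler_wpM2l ?sqn_norm_le ?ltW //.
by move=> i iU; rewrite mxE (negPf iU).
Qed.

(** Test with the indicator vector of the edge: both its form and its squared norm equal 2. *)
Lemma form_le_edge (U : {set 'I_n}) rho x y : form_le U rho -> x \in U -> y \in U -> G x y ->
  1 <= rho.
Proof.
move=> Ur xU yU xy; pose v : 'rV[R]_n := delta_mx 0 x + delta_mx 0 y.
have xy0 : x != y by apply: contraTneq xy => ->; rewrite adj_irr.
have dd (a b : 'I_n) : dot (delta_mx 0 a) (delta_mx 0 b : 'rV[R]_n) = (a == b)%:R.
  rewrite /dot trmx_delta; have [->|ab] := eqVneq a b.
    by rewrite mul_delta_mx mxE eqxx.
  by rewrite mul_delta_mx_0 // mxE.
have dA (a b : 'I_n) : dot (delta_mx 0 a *m A) (delta_mx 0 b : 'rV[R]_n) = (G a b)%:R.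
  by rewrite -rowE /dot trmx_delta -colE !mxE.
have vU : supported U v.
  move=> i iU.
  have ix : (i == x) = false by apply: contraNF iU => /eqP->.
  have iy : (i == y) = false by apply: contraNF iU => /eqP->.
  by rewrite /v !mxE ix iy !andbF addr0.
have := Ur v vU; rewrite sqnD qformD ?adjmx_sym // /sqn /qform !dd !dA !eqxx.
rewrite xy (negPf xy0) !adj_irr !mulr0n !mulr1n; lra.
Qed.

(* Attaching to [B] one vertex outside it that is adjacent to the largest entry
   of a test vector raises the Rayleigh quotient; a set smaller than the degree
   always has such a vertex. *)
Lemma form_le_shrink (d s : nat) (B U : {set 'I_n}) (rho : R) :
  regular d G -> (#|B| <= s)%N -> (0 < s)%N -> (s <= d)%N -> B != finset.set0 ->
  B \subset U -> nbhd G B \subset U -> form_le U rho ->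
  1 <= rho /\ form_le B (rho * (1 - (4 * s%:R ^+ 3)^-1)).
Proof.
move=> reg Bs s0 sd B0 BU NU Ur.
(* The vertex [u] has [d >= #|B|] neighbours and is not one of them, so they do not fit into [B]
   without [u]. *)
have out u : u \in B -> exists2 w, w \notin B & G u w.
  move=> uB; have : ~~ ([pred w | G u w] \subset B :\ u).
    apply/negP => /subset_leq_card; rewrite reg.
    move: Bs; rewrite (cardsD1 u B) uB add1n; set c := #|_| => cs dc.
    by have := leq_trans cs (leq_trans sd dc); rewrite ltnn.
  case/fintype.subsetPn => w; rewrite inE => uw; rewrite !inE negb_and negbK.
  move=> /orP[/eqP wu|wB].
    by rewrite wu adj_irr in uw.
  by exists w.
have Uout u w : u \in B -> G u w -> w \in U.
  by move=> uB uw; apply: (fintype.subsetP NU); apply/nbhdP; exists u.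
have rho1 : 1 <= rho.
  case/finset.set0Pn: B0 => u uB; have [w wB uw] := out u uB.
  by apply: (form_le_edge Ur (fintype.subsetP BU u uB) (Uout _ _ uB uw) uw).
split=> // v vB; have sR : (1 : R) <= s%:R by rewrite ler1n.
have [->|v0] := eqVneq v 0.
  by rewrite /sqn /qform /dot !mul0mx !mxE mulr0.
pose a : 'rV[R]_n := \row_i if i \in B then `|v 0 i| else 0.
have aB : supported B a by move=> i iB; rewrite mxE (negPf iB).
have va : qform A v <= qform A a.
  have -> : qform A v = qform (indmx B) v.
    rewrite !qformE; apply: eq_bigr => j _; apply: eq_bigr => i _; rewrite !mxE.
    have [iB|iB] := boolP (i \in B); last by rewrite (vB i) // !mul0r.
    by have [jB|jB] := boolP (j \in B); last by rewrite (vB j) // !mulr0.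
  exact: le_trans (ler_norm _) (qform_norm _ _).
have a_v : sqn a = sqn v.
  rewrite !sqnE; apply: eq_bigr => i _; rewrite mxE; case: ifPn => iB.
    by rewrite real_normK // num_real.
  by rewrite vB.
rewrite -a_v; apply: le_trans va _.
have a0 i : 0 <= a 0 i by rewrite mxE; case: ifP.
have a_gt0 : 0 < sqn a by rewrite lt_def sqn_ge0 a_v sqn_eq0 v0.
have rho2 : 0 < rho by lra.
have s4 : (4 * s%:R ^+ 3)^-1 <= 4^-1 :> R.
  rewrite lef_pV2 ?posrE //; last by rewrite mulr_gt0 // exprn_gt0 //; lra.
  by rewrite -{1}[4]mulr1 ler_wpM2l // exprn_ege1.
(* For [rho >= 2 s] the crude bound [s * sqn a] on the form already suffices, as [s <= rho / 2].
   Otherwise [rho < 2 s], which is used in [K] below. *)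
have [rs|rs] := lerP (2 * s%:R) rho.
  rewrite (@le_trans _ _ (s%:R * sqn a)) //; last first.
    rewrite ler_wpM2r ?sqn_ge0 // (@le_trans _ _ (rho * (1 - 4^-1))) //; first lra.
    by rewrite ler_wpM2l //; lra.
  rewrite qformE (bigID [in B]) /= [X in _ + X]big1 ?addr0; last first.
    by move=> j jB; rewrite big1 // => i _; rewrite (aB j) // mulr0.
  rewrite (@le_trans _ _ (\sum_(j in B) \sum_(i in B) (a 0 i ^+ 2 + a 0 j ^+ 2) / 2)) //.
    apply: ler_sum => j jB; rewrite (bigID [in B]) /= [X in _ + X]big1 ?addr0; last first.
      by move=> i iB; rewrite (aB i) // !mul0r.
    apply: ler_sum => i iB; rewrite (@le_trans _ _ (a 0 i * a 0 j)) //.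
      rewrite mulrAC ler_piMr ?mulr_ge0 // !mxE; by case: (G _ _).
    have := sqr_ge0 (a 0 i - a 0 j); lra.
  have sumB : \sum_(i in B) a 0 i ^+ 2 = sqn a.
    rewrite sqnE [RHS](bigID [in B]) /= [X in _ = _ + X]big1 ?addr0 // => i iB.
    by rewrite aB // expr0n.
  rewrite (eq_bigr (fun j => sqn a / 2 + #|B|%:R * (a 0 j ^+ 2 / 2))); last first.
    move=> j _; rewrite -mulr_suml big_split /= sumB sumr_const.
    by rewrite mulrDl -[X in _ + X / _]mulr_natl mulrA.
  rewrite big_split /= sumr_const -mulr_sumr -mulr_suml sumB -[X in X + _]mulr_natl.
  rewrite -mulrDr -splitr ler_wpM2r ?sqn_ge0 // ler_nat //.
have [u0 u0B] := finset.set0Pn _ B0.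
pose u := [arg max_(i > u0 in B) a 0 i]%O.
have [uB umax] : u \in B /\ forall i, i \in B -> a 0 i <= a 0 u.
  by rewrite /u; case: arg_maxP.
have [w wB uw] := out u uB.
have au : sqn a <= s%:R * a 0 u ^+ 2.
  rewrite sqnE (bigID [in B]) /= [X in _ + X]big1 ?addr0; last first.
    by move=> i iB; rewrite aB // expr0n.
  rewrite (@le_trans _ _ (\sum_(i in B) a 0 u ^+ 2)) //.
    by apply: ler_sum => i iB; rewrite lerXn2r ?nnegrE ?umax.
  by rewrite sumr_const -[X in X <= _]mulr_natl ler_wpM2r ?sqr_ge0 // ler_nat.
(* This [t] maximizes the gain [2 * t * a 0 u - rho * t ^+ 2]; its value [a 0 u ^+ 2 / rho] is at
   least [sqn a / (s * rho)] by [au]. *)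
pose t := a 0 u / rho; pose e : 'rV[R]_n := delta_mx 0 w.
have dote (z : 'rV[R]_n) : dot z e = z 0 w by rewrite /dot trmx_delta -colE mxE.
have : qform A (a + t *: e) <= rho * sqn (a + t *: e).
  apply: Ur => i iU; rewrite !mxE (_ : i \in B = false); last first.
    by apply: contraNF iU => /(fintype.subsetP BU).
  rewrite (_ : i == w = false) /= ?mulr0 ?addr0 //.
  by apply: contraNF iU => /eqP->; apply: Uout uw.
rewrite qformD ?adjmx_sym // sqnD qformZ sqnZ !dotZr !dote (aB w wB) mulr0.
have -> : qform A e = 0 by rewrite /qform dote -rowE !mxE adj_irr.
have -> : sqn e = 1 by rewrite /sqn dote mxE !eqxx.
have t0 : 0 <= t by rewrite divr_ge0 // ltW.
have H1 : t * a 0 u <= t * (a *m A) 0 w.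
  rewrite ler_wpM2l // [(a *m A) 0 w]mxE (bigD1 u) //= [A u w]mxE uw mulr1.
  rewrite lerDl sumr_ge0 // => i _.
  by rewrite mulr_ge0 // mxE.
rewrite !mulr0 !addr0 mulr1 => H2.
have tE : rho * t ^+ 2 = t * a 0 u by rewrite /t; field; rewrite gt_eqF.
have H3 : qform A a <= rho * sqn a - t * a 0 u by move: H1 H2; rewrite mulrDr tE; lra.
apply: le_trans H3 _; rewrite mulrBr mulr1 mulrBl lerD2l lerN2.
have t1 : t * a 0 u = a 0 u ^+ 2 / rho by rewrite /t; field; rewrite gt_eqF.
have s_gt0 : (0 : R) < s%:R by lra.
have s3 : 0 < 4 * s%:R ^+ 3 :> R by rewrite mulr_gt0 // exprn_gt0.
have K : rho ^+ 2 * (4 * s%:R ^+ 3)^-1 <= s%:R^-1.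
  rewrite ler_pdivrMr // (_ : _ * _ = (2 * s%:R) ^+ 2); last first.
    by field; rewrite gt_eqF.
  by rewrite lerXn2r ?nnegrE ?mulr_ge0 // ltW.
rewrite t1 ler_pdivlMr // (_ : _ * _ * _ * _ = rho ^+ 2 * (4 * s%:R ^+ 3)^-1 * sqn a).
  by rewrite (le_trans (ler_wpM2r (sqn_ge0 a) K)) // ler_pdivrMl.
by ring.
Qed.
End Graph.

(** * Bound for fixed parameters *)

Lemma count_le_sum_cover (T I : eqType) (a : pred T) (b : I -> pred T)
    (l : seq T) (r : seq I) :
  {in l, forall p, a p -> exists2 i, i \in r & b i p} ->
  (count a l <= \sum_(i <- r) count (b i) l)%N.
Proof.
elim: l => [|p l IH] H /=; first by rewrite big1.
rewrite big_split leq_add //=; last by apply: IH => u ul; apply: H; rewrite inE ul orbT.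
case ap: (a p) => //=; have [i ir bi] := H p (mem_head _ _) ap.
by rewrite (big_rem i) //= bi.
Qed.

Section FiniteBound.
Variables (R : realType) (n d : nat) (G : sgraph n).
Hypothesis reg : regular d G.
Hypothesis d_gt0 : (0 < d)%N.

Local Notation A := (adjmx R G).
Local Notation lam := (lambda (nadjmx R d G) 2).
Local Notation rho := (d%:R * lambda (nadjmx R d G) 2 : R).

Let dR_gt0 : (0 : R) < d%:R. Proof. by rewrite ltr0n. Qed.

Lemma nadjmx_sym : (nadjmx R d G)^T = nadjmx R d G.
Proof. by rewrite /nadjmx linearZ /= adjmx_sym. Qed.

Lemma qform_nadjmx (v : 'rV[R]_n) : qform (nadjmx R d G) v = d%:R^-1 * qform A v.
Proof. by rewrite /qform /nadjmx -scalemxAr dotZl. Qed.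

Lemma not_form_leP (U : {set 'I_n}) : ~ form_le G U rho ->
  exists v : 'rV[R]_n, [/\ supported U v, v != 0 &
    lam < qform (nadjmx R d G) v / sqn v].
Proof.
move=> /existsNP[v /not_implyP[vU]] /negP; rewrite -ltNge => H; exists v.
have v0 : v != 0.
  by apply: contraTneq H => ->; rewrite /qform /sqn /dot !mul0mx !mxE mulr0 ltxx.
split=> //; have sv : 0 < sqn v by rewrite lt_def sqn_eq0 v0 sqn_ge0.
by rewrite ltr_pdivlMr // qform_nadjmx ltr_pdivlMl // mulrA.
Qed.

(* Test vectors of Rayleigh quotient above the second eigenvalue on two sets
   with no edge between them would give two eigenvalues above it. *)
Lemma form_le_separated (U W : {set 'I_n}) :
  (forall u w, u \in U -> w \in W -> u != w /\ ~~ G u w) ->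
  form_le G U rho \/ form_le G W rho.
Proof.
move=> UW; apply/or_asboolP; rewrite -[_ || _]negbK negb_or; apply/negP.
move=> /andP[/asboolPn/not_form_leP[v [vU v0 lv]] /asboolPn/not_form_leP[w [wW w0 lw]]].
pose t := Num.min (qform (nadjmx R d G) v / sqn v) (qform (nadjmx R d G) w / sqn w).
have : lam < t by rewrite lt_min lv lw.
rewrite ltNge => /negP; apply.
have sv : 0 < sqn v by rewrite lt_def sqn_eq0 v0 sqn_ge0.
have sw : 0 < sqn w by rewrite lt_def sqn_eq0 w0 sqn_ge0.
apply: (@second_eigenvalue_ge_forms _ _ _ _ v w) => //; first exact: nadjmx_sym.
- rewrite dotE big1 // => i _; have [iU|/vU->] := boolP (i \in U); last by rewrite mul0r.
  have [iW|/wW->] := boolP (i \in W); last by rewrite mulr0.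
  by have [] := UW i i iU iW; rewrite eqxx.
- rewrite dotE big1 // => j _; have [jW|/wW->] := boolP (j \in W); last by rewrite mulr0.
  rewrite mxE big1 ?mul0r // => i _.
  have [iU|/vU->] := boolP (i \in U); last by rewrite mul0r.
  by have [_ /negPf ij] := UW i j iU jW; rewrite !mxE ij !mulr0.
- by rewrite -ler_pdivlMr // ge_min lexx.
- by rewrite -ler_pdivlMr // ge_min lexx orbT.
Qed.

Definition exceptional (r : nat) : {set 'I_n} :=
  [set x | ~~ `[< form_le G (gball G r x) rho >]].

Lemma not_exceptional_form_le r x : x \notin exceptional r -> form_le G (gball G r x) rho.
Proof. by rewrite inE negbK => /asboolP. Qed.

Let deg v : (#|[pred w | G v w]| <= d)%N. Proof. by rewrite reg. Qed.

(** Two exceptional vertices are at distance at most [2 r + 1], since otherwise their balls are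
    disjoint with no edge between them. All of them thus lie in one ball of that radius. *)
Lemma card_exceptional r : (#|exceptional r| <= d.+1 ^ r.*2.+1)%N.
Proof.
have [->|/finset.set0Pn[x xb]] := eqVneq (exceptional r) finset.set0; first by rewrite cards0.
apply: leq_trans (card_gball deg r.*2.+1 x); apply: subset_leq_card.
apply/fintype.subsetP => y yb; apply: contraT => xy.
have [] := @form_le_separated (gball G r x) (gball G r y).
- move=> u w ux wy; split.
    apply: contraNneq xy => uw; rewrite -{}uw in wy.
    have := gball_trans ux (gball_sym (@adj_sym _ G) wy).
    by rewrite addnn; apply: (fintype.subsetP (gball_le _ _ _)).
  apply: contraNN xy => uw.
  have := gball_trans (gball_step ux uw) (gball_sym (@adj_sym _ G) wy).
  by rewrite addSn addnn.
- by move=> xg; move: xb; rewrite inE => /negP; case; apply/asboolP.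
- by move=> yg; move: yb; rewrite inE => /negP; case; apply/asboolP.
Qed.

(** * Trace bound after deleting vertices *)

Variables (k s : nat).
Hypotheses (s_gt0 : (0 < s)%N) (s_le_d : (s <= d)%N) (s_lt_k : (s < k.*2)%N).
Local Notation walkx x := (walks G k.*2 x).
Local Notation mu := (rho * (1 - (4 * s%:R ^+ 3)^-1) : R).

(** Such a set has radius at most [s - 1] about [x], so its neighbours are still inside the ball of
    radius [2 k], where the form is at most [rho]. *)
Lemma grown_set_form x (B : {set 'I_n}) : x \notin exceptional k.*2 ->
  B \in grown_sets G s.-1 x -> 1 <= rho /\ form_le G B mu.
Proof.
move=> /not_exceptional_form_le xg /grown_setsP[xB BU cB].
apply: (form_le_shrink reg _ s_gt0 s_le_d _ _ _ xg).
- by rewrite (prednK s_gt0) in cB.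
- by apply/finset.set0Pn; exists x.
- apply: (fintype.subset_trans BU); apply: gball_le.
  exact: leq_trans (leq_pred _) (ltnW s_lt_k).
apply/fintype.subsetP => y /nbhdP[z zB zy].
apply: (fintype.subsetP (gball_le _ _ (ltnW s_lt_k))).
rewrite -(prednK s_gt0); apply: gball_step zy; exact: (fintype.subsetP BU).
Qed.

Lemma rho_ge1 x : x \notin exceptional k.*2 -> 1 <= rho.
Proof.
move=> xg; have := @grown_set_form x [set x] xg; case=> //.
apply: (@grown_sets_mono _ _ 0) => //; by rewrite inE.
Qed.

Let s4 : 0 < 1 - (4 * s%:R ^+ 3)^-1 :> R.
Proof.
have s1 : (1 : R) <= s%:R by rewrite ler1n.
have := exprn_ege1 3 s1; rewrite subr_gt0 => s3.
by rewrite invf_lt1; lra.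
Qed.

(** Union bound over the grown sets: the visited set of such a walk is one of them, and each carries
    at most [mu ^+ k.*2] closed walks at [x]. *)
Lemma small_walks x : x \notin exceptional k.*2 ->
  (count (fun p => (last x p == x) && (#|visited x p| <= s)%N) (walkx x))%:R <=
  ((s * d).+1 ^ s)%:R * mu ^+ k.*2.
Proof.
move=> xg; have rho1 := rho_ge1 xg.
pose b (B : {set 'I_n}) p := (last x p == x) && all [in B] p.
have mu0 : 0 < mu by rewrite mulr_gt0 //; lra.
apply: (@le_trans _ _ (\sum_(B <- grown_sets G s.-1 x) count (b B) (walkx x))%N%:R).
  rewrite ler_nat; apply: count_le_sum_cover => p /walksP[pp _] /andP[lx tp].
  exists (visited x p).
    by apply: (grown_sets_mono _ (grown_sets_path pp)); move: tp; lia.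
  by rewrite /b lx; apply/allP => z zp; rewrite !inE zp orbT.
rewrite natr_sum (@le_trans _ _ (\sum_(B <- grown_sets G s.-1 x) mu ^+ k.*2)) //.
  rewrite big_seq [X in _ <= X]big_seq; apply: ler_sum => B Bg.
  have [_ Bmu] := grown_set_form xg Bg; have [xB _ _] := grown_setsP Bg.
  exact: closed_walks_le.
rewrite big_const_seq count_predT iter_addr_0 -[X in X <= _]mulr_natl.
rewrite ler_wpM2r ?(exprn_ge0 _ (ltW mu0)) // ler_nat.
rewrite (leq_trans (@size_grown_sets _ _ _ deg s.-1 s x _)) ?prednK //.
by rewrite leq_pexp2l // leq_pred.
Qed.

(** A walk of length [2 k] never leaves the ball of radius [2 k], on which the form is at most
    [rho]. *)
Lemma closed_walks_total x : x \notin exceptional k.*2 ->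
  (count (fun p => last x p == x) (walkx x))%:R <= rho ^+ k.*2.
Proof.
move=> xg; have rho1 := rho_ge1 xg.
have -> : count (fun p => last x p == x) (walkx x) =
    count (fun p => (last x p == x) && all [in gball G k.*2 x] p) (walkx x).
  apply: eq_in_count => p /walksP[pp sp] /=.
  rewrite (_ : all _ _) ?andbT //; apply/allP => z zp.
  by have := path_gball pp; rewrite sp; apply; rewrite inE zp orbT.
apply: closed_walks_le; [exact: not_exceptional_form_le| lra |exact: gball_center].
Qed.

Definition avoiding (X : {set 'I_n}) x :=
  count (fun p => [&& last x p == x, (s < #|visited x p|)%N & [disjoint visited x p & X]])
    (walkx x).

Lemma hitting_set_walks (q : nat) : (s <= n)%N -> exists2 X : {set 'I_n}, (#|X| <= q)%N &
  (\sum_(x in ~: exceptional k.*2) avoiding X x)%N%:R <=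
    (1 - s%:R / n%:R) ^+ q * (n%:R * rho ^+ k.*2).
Proof.
move=> sn; have n_gt0 : (0 < n)%N := leq_trans s_gt0 sn.
pose w x := [seq p <- walkx x | (last x p == x) && (s < #|visited x p|)%N].
(* Visited sets are listed once per walk, so that counting in [L] counts walks. *)
pose L := flatten [seq [seq visited x p | p <- w x] | x <- enum (~: exceptional k.*2)].
have sumL (a : pred {set 'I_n}) :
    count a L = (\sum_(x in ~: exceptional k.*2) count (fun p => a (visited x p)) (w x))%N.
  rewrite /L count_flatten -map_comp sumnE big_map big_enum /=.
  by apply: eq_bigr => x _; rewrite count_map.
have [|X Xq] := @hitting_set _ L s q.
  move=> B /flatten_mapP[x _ /mapP[p]]; rewrite mem_filter => /andP[/andP[_ sp] _] ->.
  exact: ltnW.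
rewrite card_ord => H; exists X => //.
have -> : (\sum_(x in ~: exceptional k.*2) avoiding X x)%N =
    count (fun B : {set 'I_n} => [disjoint B & X]) L.
  rewrite sumL; apply: eq_bigr => x _; rewrite count_filter; apply: eq_count => p /=.
  by rewrite andbA andbC.
have sL : (size L)%:R <= n%:R * rho ^+ k.*2.
  rewrite -(count_predT L) sumL natr_sum.
  rewrite (@le_trans _ _ (\sum_(x in ~: exceptional k.*2) rho ^+ k.*2)) //.
    apply: ler_sum => x; rewrite inE => xg; apply: le_trans (closed_walks_total xg).
    rewrite ler_nat count_filter; apply: sub_count => p /=.
    by case/andP.
  have [->|/finset.set0Pn[x]] := eqVneq (~: exceptional k.*2) finset.set0.
    by rewrite big_set0 mulr_ge0 // exprn_even_ge0 // odd_double.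
  rewrite inE => xg; have rho1 := rho_ge1 xg.
  rewrite sumr_const -[X in X <= _]mulr_natl ler_wpM2r ?exprn_ge0 //; first lra.
  by rewrite ler_nat -[X in (_ <= X)%N](card_ord n) max_card.
have nR : (0 : R) < n%:R by rewrite ltr0n.
have -> : 1 - s%:R / n%:R = (n - s)%N%:R / n%:R :> R.
  by rewrite natrB // mulrBl divff // gt_eqF.
rewrite exprMn exprVn mulrAC ler_pdivlMr ?exprn_gt0 //.
apply: le_trans (ler_wpM2l _ sL); last by rewrite exprn_ge0.
by rewrite -!natrX -!natrM ler_nat.
Qed.

(** The trace counts the closed walks inside the remaining vertices. Each has at most [s] distinct
    vertices, or has more and misses [X]. *)
Lemma mxtrace_indmx_le (X : {set 'I_n}) :
  \tr (indmx R G (~: (exceptional k.*2 :|: X)) ^+ k.*2) <=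
  n%:R * (((s * d).+1 ^ s)%:R * mu ^+ k.*2) +
  (\sum_(x in ~: exceptional k.*2) avoiding X x)%N%:R.
Proof.
set U := ~: _; rewrite /mxtrace.
have F0 : 0 <= ((s * d).+1 ^ s)%:R * mu ^+ k.*2.
  by rewrite mulr_ge0 // exprn_even_ge0 // odd_double.
rewrite (bigID [in ~: exceptional k.*2]) /= [X in _ + X]big1 ?addr0; last first.
  move=> x; rewrite inE negbK => xb.
  (* The exponent must be positive: one factor, whose row [x] is zero, is split off. *)
  have -> : k.*2 = k.*2.-1.+1 by rewrite prednK // (leq_ltn_trans _ s_lt_k).
  rewrite exprS -mulmxE mxE big1 // => y _.
  by rewrite mxE finset.in_setC finset.in_setU xb mul0r.
rewrite natr_sum (@le_trans _ _ (\sum_(x in ~: exceptional k.*2)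
   (((s * d).+1 ^ s)%:R * mu ^+ k.*2 + (avoiding X x)%:R))) //.
  apply: ler_sum => x; rewrite inE => xg.
  have [xU|xU] := boolP (x \in U); last first.
    have -> : k.*2 = k.*2.-1.+1 by rewrite prednK // (leq_ltn_trans _ s_lt_k).
    rewrite [X in X <= _](_ : _ = 0); last first.
      rewrite exprS -mulmxE mxE big1 // => y _.
      by rewrite mxE (negPf xU) mul0r.
    by rewrite addr_ge0 // prednK // (leq_ltn_trans _ s_lt_k).
  rewrite exprmx_walks //; apply: le_trans (lerD (small_walks xg) (lexx _)).
  rewrite -natrD ler_nat /avoiding; elim: (walkx x) => //= p l IH.
  rewrite addnACA leq_add //.
  have [lx|//] := eqVneq (last x p) x; rewrite /=.
  have [pU|//] := boolP (all _ p); rewrite /= [(#|_| <= s)%N]leqNgt; case: (s < _)%N => //=.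
  suff -> : [disjoint visited x p & X] by [].
  rewrite finset.disjoints_subset; apply/fintype.subsetP => z.
  rewrite inE inE => /orP[/eqP->|zp].
    by move: xU; rewrite /U !finset.in_setC finset.in_setU negb_or => /andP[_].
  by have := allP pU z zp; rewrite /U !finset.in_setC finset.in_setU negb_or => /andP[_].
rewrite big_split /= lerD2r sumr_const -[X in X <= _]mulr_natl ler_wpM2r //.
by rewrite ler_nat -[X in (_ <= X)%N](card_ord n) max_card.
Qed.

(** Interlacing charges the deleted vertices, which give the first two terms. The other eigenvalues
    counted are at least [(1 - eps) * lam], so the trace of the power [2 k] bounds their number, and
    [rho ^+ k.*2] cancels. The bound on [n] leaves a vertex that is not exceptional, whence
    [lam > 0]. *)
Lemma eig_count_finite (q : nat) (eps : R) :
  (d.+1 ^ (4 * k).+1 < n)%N -> (s <= n)%N -> 0 <= eps < 1 ->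
  (eig_count (nadjmx R d G) `[(1 - eps) * lam, lam]%R)%:R <=
  q%:R + (d.+1 ^ (4 * k).+1)%:R + n%:R / (1 - eps) ^+ k.*2 *
    (((s * d).+1 ^ s)%:R * (1 - (4 * s%:R ^+ 3)^-1) ^+ k.*2 + (1 - s%:R / n%:R) ^+ q).
Proof.
move=> dn sn /andP[eps0 eps1].
have cb : (#|exceptional k.*2| <= d.+1 ^ (4 * k).+1)%N.
  by rewrite (_ : (4 * k = k.*2.*2)%N) ?card_exceptional //; lia.
have [x xg] : exists x, x \notin exceptional k.*2.
  apply/existsP; rewrite -negb_forall; apply/negP => /forallP ab.
  have : (n <= #|exceptional k.*2|)%N.
    rewrite -[X in (X <= _)%N](card_ord n) -cardsT; apply: subset_leq_card.
    by apply/fintype.subsetP => y _; have := ab y; rewrite ?negbK.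
  by rewrite leqNgt (leq_ltn_trans cb).
have rho1 := rho_ge1 xg.
have [X Xq HX] := hitting_set_walks q sn.
set U := ~: (exceptional k.*2 :|: X); pose M := d%:R^-1 *: indmx R G U.
have trU := mxtrace_indmx_le X; rewrite -/U in trU.
have sM : M^T = M by rewrite /M linearZ /= indmx_sym.
have lam0 : 0 < lam by rewrite -(pmulr_rgt0 _ dR_gt0); lra.
pose t := (1 - eps) * lam.
have t0 : 0 < t by rewrite mulr_gt0 // subr_gt0.
pose c := count (fun x => t <= x)%R (eigenvalues M).
have cM : (eig_count (nadjmx R d G) `[t, lam]%R <= #|exceptional k.*2 :|: X| + c)%N.
  apply: leq_trans (@interlacing _ _ (nadjmx R d G) M (exceptional k.*2 :|: X) t
    nadjmx_sym sM _).
    by apply: sub_count => y; rewrite /= in_itv /= => /andP[].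
  by move=> i j iX jX; rewrite !mxE !finset.in_setC iX jX.
(* The exponent is even, so eigenvalues below [t], even negative ones, contribute nonnegatively. *)
have trM : c%:R * t ^+ k.*2 <= \tr (M ^+ k.*2).
  rewrite mxtrace_eigenvalues // /c; elim: (eigenvalues M) => [|y l IH] /=.
    by rewrite big_nil mul0r.
  rewrite big_cons natrD mulrDl lerD //; have [ty|_] := lerP t y.
    by rewrite mul1r lerXn2r ?nnegrE // ltW // (lt_le_trans t0).
  by rewrite mul0r exprn_even_ge0 // odd_double.
have Mk j : M ^+ j = d%:R^-1 ^+ j *: indmx R G U ^+ j.
  elim: j => [|j IH]; first by rewrite !expr0 scale1r.
  by rewrite !exprS IH /M -!mulmxE -scalemxAl -scalemxAr scalerA.
have {}trM : c%:R * ((1 - eps) ^+ k.*2 * rho ^+ k.*2) <= \tr (indmx R G U ^+ k.*2).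
  move: trM; rewrite Mk mxtraceZ exprVn [X in _ <= X]mulrC.
  rewrite ler_pdivlMr ?exprn_gt0 // ?mulr_gt0 // => H.
  apply: le_trans H; rewrite le_eqVlt; apply/orP; left; apply/eqP.
  by rewrite /t !exprMn; ring.
have r0 : 0 < rho ^+ k.*2 by rewrite exprn_gt0 //; lra.
have e0 : 0 < (1 - eps) ^+ k.*2 by rewrite exprn_gt0 // subr_gt0.
set Q := ((s * d).+1 ^ s)%:R * (1 - (4 * s%:R ^+ 3)^-1) ^+ k.*2 + (1 - s%:R / n%:R) ^+ q.
have cQ : c%:R <= n%:R / (1 - eps) ^+ k.*2 * Q.
  rewrite mulrAC ler_pdivlMr // -(ler_pM2r r0) -mulrA (le_trans trM) //.
  rewrite (le_trans trU) // (le_trans (lerD (lexx _) HX)) //.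
  rewrite le_eqVlt; apply/orP; left; apply/eqP.
  by rewrite /Q exprMn; ring.
apply: le_trans (lerD (lexx _) cQ); rewrite -!natrD ler_nat.
rewrite (leq_trans cM) // leq_add2r (leq_trans (leq_card_setU _ _)) // addnC.
by rewrite leq_add.
Qed.
End FiniteBound.

(** * Asymptotics *)

Section Estimates.
Variable R : realType.

Lemma ln_le_half (x : R) : 0 < x -> ln x <= x / 2.
Proof.
move=> x0; have -> : x = 2 * (x / 2) by field.
rewrite lnM ?posrE ?divr_gt0 //.
have := @le_ln1Dx R 1 ltac:(lra); rewrite (_ : 1 + 1 = 2 :> R) ?natr1 // => l2.
have := @le_ln1Dx R (x / 2 - 1) ltac:(lra); rewrite addrC subrK; lra.
Qed.

Lemma expR1_le4 : expR 1 <= 4 :> R.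
Proof.
rewrite [X in expR X](_ : 1 = 2^-1 + 2^-1); last by field.
have := @expR_ge1Dx R (- 2^-1); rewrite expRN expRD => H.
have e0 := expR_gt0 (2^-1 : R).
have {}H : expR (2^-1 : R) <= 2.
  rewrite -lef_pV2 ?posrE //; apply: le_trans H; lra.
rewrite (_ : 4 = 2 * 2 :> R); last by ring.
by apply: ler_pM => //; apply: ltW.
Qed.

Lemma onem_exp_le (a : R) j : a <= 1 -> (1 - a) ^+ j <= expR (- (a * j%:R)).
Proof.
move=> a1; rewrite -mulNr expRM_natr lerXn2r ?nnegrE ?expR_ge0 ?subr_ge0 //.
exact: expR_ge1Dx.
Qed.

Lemma onem_expV_le (a : R) j : 0 <= a -> a <= 2^-1 ->
  ((1 - a) ^+ j)^-1 <= expR (2 * a * j%:R).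
Proof.
move=> a0 a1; have a2 : 0 < 1 - a by lra.
rewrite -exprVn expRM_natr lerXn2r ?nnegrE ?expR_ge0 ?invr_ge0 ?(ltW a2) //.
apply: le_trans (expR_ge1Dx _); rewrite -[_^-1]mul1r ler_pdivrMr //.
have : 0 <= a * (1 - 2 * a) by rewrite mulr_ge0 //; lra.
lra.
Qed.

Lemma eig_count_le_size n d (G : sgraph n) (I : interval R) :
  (eig_count (nadjmx R d G) I <= n)%N.
Proof.
rewrite -[X in (_ <= X)%N](size_eigenvalues (nadjmx_sym R d G)).
exact: count_size.
Qed.

(** Applied with [y] and [h] the fourth root of [ln n] and the square root of [D = ln d],
    [L = log_d n], [l = ln ln n] and [S = s]. All follows from [S * h <= y / 100]: its fourth power
    gives the first bound, its cube times [l <= 4 * y] the second. *)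
Lemma growth_bounds (y h D L l S : R) : 0 < y -> 1 <= h -> h ^+ 2 = D ->
  L * D = y ^+ 4 -> 0 < l -> l <= 4 * y -> 1 <= S -> 100 * (S * h) <= y ->
  [/\ 1000 * (S ^+ 4 * D) <= L, 1000 * (l * S ^+ 3) <= L & 1000 * S <= L].
Proof.
move=> y0 h1 h2 LD l0 ly S1 Shy.
have D1 : 1 <= D by rewrite -h2 exprn_ege1.
have D0 : 0 < D by lra.
have c0 : (0 : R) < 1000 by lra.
have Sh0 : 0 <= S * h by rewrite mulr_ge0 //; lra.
have Shy' : S * h <= y / 100 by rewrite ler_pdivlMr //; lra.
have S4 : 1000 * (S ^+ 4 * D) <= L.
  rewrite -(ler_pM2r D0) LD.
  have : (S * h) ^+ 4 <= (y / 100) ^+ 4.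
    by rewrite lerXn2r ?nnegrE // divr_ge0 // ltW.
  have -> : (S * h) ^+ 4 = S ^+ 4 * D * D by rewrite -h2; ring.
  have -> : (y / 100) ^+ 4 = y ^+ 4 / 100 ^+ 4 by field.
  have := exprn_gt0 4 y0; lra.
split=> //.
  have H : l * (S * h) ^+ 3 <= 4 * y * (y / 100) ^+ 3.
    apply: ler_pM => //; rewrite ?exprn_ge0 ?(ltW l0) //.
    by rewrite lerXn2r ?nnegrE // divr_ge0 // ltW.
  have {H} H : 1000 * (l * S ^+ 3 * h) * D <= L * D.
    rewrite LD; have -> : 1000 * (l * S ^+ 3 * h) * D = 1000 * (l * (S * h) ^+ 3).
      by rewrite -h2; ring.
    have E : 4 * y * (y / 100) ^+ 3 = 4 * y ^+ 4 / 100 ^+ 3 by field.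
    rewrite E in H; have := exprn_gt0 4 y0; move: H; lra.
  rewrite (ler_pM2r D0) in H; apply: le_trans H.
  rewrite (ler_pM2l c0) ler_peMr // mulr_ge0 ?(ltW l0) // exprn_ge0 //; lra.
apply: le_trans S4; rewrite (ler_pM2l c0) exprSr mulrAC ler_peMl //; first lra.
exact: mulr_ege1 (exprn_ege1 3 S1) D1.
Qed.

(** As [d + 1 <= d ^ 2] and [k <= L / 32], the left side is at most the square root of [n], that is
    [expR (N / 2)]; and [N <= expR (N / 2)]. *)
Lemma exp_ball_bound (n d k : nat) (D L : R) : (2 <= d)%N -> d%:R = expR D ->
  n%:R = expR (L * D) -> 1 <= D -> 1000 <= L -> k%:R <= L / 32 ->
  (d.+1 ^ (4 * k).+1)%N%:R <= n%:R / (L * D).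
Proof.
move=> d2 dE nE D1 L3 kL; set N := L * D in nE *.
have N0 : 0 < N by rewrite mulr_gt0 //; lra.
rewrite (@le_trans _ _ ((d ^ 2) ^ (4 * k).+1)%N%:R) //.
  by rewrite ler_nat leq_exp2r //; move: d2; nia.
rewrite !natrX dE -!expRM_natr (@le_trans _ _ (expR (N / 2))) //.
  rewrite ler_expR -[(4 * k).+1%:R]natr1 natrM /N.
  have D0 : 0 <= D by lra.
  have := ler_wpM2r D0 kL; have := ler_wpM2r D0 L3; lra.
rewrite ler_pdivlMr // nE [X in _ <= expR X](splitr N) expRD ler_pM2l ?expR_gt0 //.
by rewrite -[X in X <= _](@lnK _ N) ?posrE // ler_expR ln_le_half.
Qed.

(** The number of sets is at most [d ^ (3 s) = expR (3 * s * D)], while the shrinking factor is at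
    most [expR (- (2 * k / (4 * s ^ 3)))]. The two growth hypotheses make the latter win by
    [2 * l]. *)
Lemma few_small_walks (d k s : nat) (D L l : R) : (2 <= d)%N -> d%:R = expR D ->
  (0 < s)%N -> (s <= d)%N -> 0 <= L -> L / 64 <= k%:R ->
  1000 * (s%:R ^+ 4 * D) <= L -> 1000 * (l * s%:R ^+ 3) <= L ->
  ((s * d).+1 ^ s)%N%:R * (1 - (4 * s%:R ^+ 3)^-1) ^+ k.*2 <= expR (- (2 * l)).
Proof.
move=> d2 dE s1 sd L0 k64 S4 S3; have S1 : (1 : R) <= s%:R by rewrite ler1n.
have s3 := exprn_ege1 3 S1.
have a1 : (4 * s%:R ^+ 3)^-1 <= 1 :> R by rewrite invf_le1; lra.
apply: (@le_trans _ _ (expR (3 * s%:R * D) * expR (- ((4 * s%:R ^+ 3)^-1 * k.*2%:R)))).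
  apply: ler_pM => //.
  - by rewrite exprn_ge0 // subr_ge0.
  - rewrite (@le_trans _ _ ((d ^ 3) ^ s)%N%:R) //.
      by rewrite ler_nat leq_exp2r //; move: sd d2; clear; nia.
    by rewrite !natrX dE -!expRM_natr ler_expR; lra.
  - exact: onem_exp_le.
have s30 : 0 < 4 * s%:R ^+ 3 :> R by lra.
rewrite -expRD ler_expR; set K := _^-1 * _.
suff : 3 * s%:R * D + 2 * l <= K by lra.
rewrite /K ler_pdivlMl // -muln2 natrM.
have -> : 4 * s%:R ^+ 3 * (3 * s%:R * D + 2 * l) =
    12 * (s%:R ^+ 4 * D) + 8 * (l * s%:R ^+ 3) by ring.
lra.
Qed.

(** This is where the width of the interval enters: with [eps = ln L / L] the loss is at most
    [expR (4 * k * eps)], hence at most [expR (ln L / 8)]. *)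
Lemma interval_width_factor (k : nat) (L : R) : 1 <= L -> k%:R <= L / 32 ->
  ((1 - ln L / L) ^+ k.*2)^-1 <= L /\ 0 <= ln L / L <= 2^-1.
Proof.
move=> L1 kL; have L0 : 0 < L by lra.
have eps0 : 0 <= ln L / L by rewrite divr_ge0 ?ln_ge0 // ltW.
have eps2 : ln L / L <= 2^-1 by rewrite ler_pdivrMr // mulrC ln_le_half.
rewrite eps0 eps2; split=> //.
apply: le_trans (onem_expV_le _ eps0 eps2) _.
rewrite -[X in _ <= X](@lnK _ L) ?posrE // ler_expR.
rewrite -muln2 natrM (_ : _ * _ = ln L * (k%:R * 4) / L); last by ring.
rewrite ler_pdivrMr // ler_wpM2l ?ln_ge0 //; lra.
Qed.

Lemma residual_bound (a F N T1 T2 : R) : 0 <= a -> 0 < N -> 0 < F -> F^-1 <= N ->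
  T1 <= (N ^+ 2)^-1 -> T2 <= (N ^+ 2)^-1 -> a / F * (T1 + T2) <= 2 * (a / N).
Proof.
move=> a0 N0 F0 FN H1 H2; have T : T1 + T2 <= 2 * (N ^+ 2)^-1 by lra.
have NN : 0 <= 2 * (N ^+ 2)^-1 by rewrite mulr_ge0 // invr_ge0 sqr_ge0.
have -> : 2 * (a / N) = a * N * (2 * (N ^+ 2)^-1) by field; rewrite gt_eqF.
apply: le_trans (ler_wpM2r NN (ler_wpM2l a0 FN)).
by rewrite ler_wpM2l // divr_ge0 // ltW.
Qed.

(** Both regimes come from this bound, whose denominator is the order of the admissible [s]. If it
    is at most 100 the trivial count [n] suffices. *)
Lemma eig_count_uniform : exists2 K : R, 2 <= K &
  forall n d (G : sgraph n), (2 <= d)%N -> regular d G -> 1 <= ln (ln n%:R : R) ->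
  (eig_count (nadjmx R d G)
    `[(1 - ln (log (d%:R : R) n%:R) / log d%:R n%:R) * lambda (nadjmx R d G) 2,
      lambda (nadjmx R d G) 2]%R)%:R <=
  K * n%:R * ln (ln n%:R) /
    Num.min d%:R (ln n%:R `^ (1 / 4) / ln d%:R `^ (1 / 2)).
Proof.
exists 500; first by rewrite ler_nat.
move=> n d G d2 reg; set N := ln (n%:R : R); set l := ln N; set D := ln (d%:R : R) => l1.
have dR2 : (2 : R) <= d%:R by rewrite ler_nat.
have dE : d%:R = expR D by rewrite lnK // posrE; lra.
have N0 : 0 < N.
  rewrite ltNge; apply/negP => N0.
  by have := @ln_le0 R _ (le_trans N0 ler01); rewrite -/l; lra.
have NE : N = expR l by rewrite lnK.
have N2 : 2 <= N by rewrite NE; apply: le_trans (expR_ge1Dx _); lra.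
have n0 : (0 : R) < n%:R.
  (* The value [ln 0] is 0 by convention, which contradicts [N > 0]. *)
  rewrite lt0r ler0n andbT; apply: contraTneq N0 => n0.
  by rewrite /N n0 ln0 ?ltxx.
have nE : n%:R = expR N by rewrite lnK.
have D0 : 0 < D by rewrite ln_gt0 //; lra.
set y := N `^ (1 / 4); set h := D `^ (1 / 2).
have y0 : 0 < y by rewrite powR_gt0.
have h0 : 0 < h by rewrite powR_gt0.
have y4 : y ^+ 4 = N.
  by rewrite /y -powR_mulrn ?powR_ge0 // -powRrM (_ : _ * _ = 1) ?powRr1 ?ltW //; field.
have h2 : h ^+ 2 = D.
  by rewrite /h -powR_mulrn ?powR_ge0 // -powRrM (_ : _ * _ = 1) ?powRr1 ?ltW //; field.
set L := log _ _; have LD : L * D = N by rewrite /L /log divfK // gt_eqF.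
have L0 : 0 < L by rewrite divr_gt0.
set m := Num.min _ _; have m0 : 0 < m by rewrite lt_min divr_gt0 // andbT; lra.
have l0 : 0 < l by lra.
have [m100|m100] := lerP m 100.
  rewrite ler_pdivlMr // (@le_trans _ _ (n%:R * 100)) //.
    by apply: ler_pM => //; [exact: ltW|rewrite ler_nat eig_count_le_size].
  have : n%:R * 1 <= n%:R * l by rewrite ler_pM2l.
  lra.
have md : m <= d%:R by rewrite ge_min lexx.
have my : m <= y / h by rewrite ge_min lexx orbT.
have D1 : 1 <= D.
  rewrite -ler_expR -dE; apply: le_trans expR1_le4 _; lra.
have h1 : 1 <= h.
  by rewrite -(@ler_pXn2r _ 2) ?nnegrE ?expr1n ?h2 // ltW.
have yh : 100 * h < y by rewrite -ltr_pdivlMr // (lt_le_trans m100).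
have ly : l <= 4 * y.
  rewrite /l -y4 lnXn // -[X in X <= _]mulr_natl ler_pM2l //.
  exact: ltW (ln_sublinear y0).
pose s := Num.truncn (m / 100).
have [s_le s_gt] : s%:R <= m / 100 /\ m / 100 < s%:R + 1.
  have m1 : 0 <= m / 100 by lra.
  by rewrite truncn_le m1 natr1 truncnS_gt.
have s1 : (0 < s)%N by rewrite truncn_gt0; lra.
have S1 : (1 : R) <= s%:R by rewrite ler1n.
have S0 : (0 : R) < s%:R by rewrite ltr0n.
set P := n%:R * l / m.
have nmP : n%:R / m <= P by rewrite /P ler_pM2r ?invr_gt0 // ler_peMr // ltW.
have y1 : 1 <= y by move: yh h1; clear; lra.
have mN : m <= N.
  rewrite -y4 exprS (le_trans my) // ler_pM ?invr_ge0 ?(ltW y0) ?(ltW h0) //.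
  by rewrite (le_trans _ (exprn_ege1 3 y1)) // invf_le1.
have nN : n%:R / N <= P.
  by apply: le_trans nmP; rewrite ler_pM2l // lef_pV2.
have nN1 : 1 <= n%:R / N.
  rewrite ler_pdivlMr // mul1r nE; apply: le_trans (expR_ge1Dx _); by rewrite lerDr.
(* Rounding down costs a factor 2: [s >= 1] and [s > m / 100 - 1] give [s >= m / 200]. *)
have q400 : 2 * l * n%:R / s%:R <= 400 * P.
  rewrite ler_pdivrMr // (_ : 400 * P * s%:R = 2 * l * n%:R * (200 * s%:R / m)); last first.
    by rewrite /P; ring.
  rewrite ler_peMr ?mulr_ge0 ?(ltW l0) // ler_pdivlMr // mul1r.
  by move: s_gt S1; clear; lra.
have total : 2 * l * n%:R / s%:R + 1 + n%:R / N + 2 * (n%:R / N) <= 500 * n%:R * l / m.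
  rewrite (_ : 500 * _ * _ / _ = 500 * P); last by rewrite /P; ring.
  by move: q400 nN nN1; clear; lra.
have sd : (s <= d)%N by rewrite -(ler_nat R); move: s_le md m0; clear; lra.
have Sh : s%:R * h <= y / 100.
  rewrite (@le_trans _ _ (m / 100 * h)) ?ler_pM2r //.
  by rewrite mulrAC ler_pM2r // -ler_pdivlMr.
have [S4 S3 L8] : [/\ 1000 * (s%:R ^+ 4 * D) <= L, 1000 * (l * s%:R ^+ 3) <= L &
    1000 * s%:R <= L].
  apply: (growth_bounds y0 h1 h2) => //; rewrite ?y4 //.
  by rewrite mulrC -ler_pdivlMr.
have {}L8 : 1000 <= L /\ s%:R * 1000 <= L.
  by move: S1 L8; clear; split; lra.
clear nmP nN nN1 q400 mN y1.
(* Small enough for [interval_width_factor] and [exp_ball_bound], yet at least [L / 64] for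
   [few_small_walks]. *)
pose k := Num.truncn (L / 32).
have [k_le k_gt] : k%:R <= L / 32 /\ L / 32 < k%:R + 1.
  have m1 : 0 <= L / 32 by rewrite divr_ge0 // ltW.
  by rewrite truncn_le m1 natr1 truncnS_gt.
have [L3 s1000] := L8.
have L1 : 1 <= L by move: L3; clear; lra.
have k64 : L / 64 <= k%:R by move: L3 k_gt; clear; lra.
have LN : L <= N by rewrite -LD ler_peMr // ltW.
have [factor /andP[eps0 eps2]] := interval_width_factor L1 k_le.
have e1 : 0 <= ln L / L < 1 by rewrite eps0; move: eps2; clear; lra.
have F0 : 0 < (1 - ln L / L) ^+ k.*2 by rewrite exprn_gt0 // subr_gt0; case/andP: e1.
(* With [q >= 2 * l * n / s], the proportion of long walks that are not hit is at most
   [expR (- (2 * l)) = N ^- 2]. *)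
pose q := (Num.truncn (2 * l * n%:R / s%:R)).+1.
have [q_ge q_le] : 2 * l * n%:R / s%:R <= q%:R /\ q%:R <= 2 * l * n%:R / s%:R + 1.
  split; first by rewrite ltW // truncnS_gt.
  by rewrite /q -[X in X <= _]natr1 lerD2r truncn_le divr_ge0 // mulr_ge0 // ltW // mulr_gt0.
have sk : (s < k.*2)%N 
  by rewrite -(ltr_nat R) -muln2 natrM; move: s1000 k64 S1; clear; lra.
have badN : (d.+1 ^ (4 * k).+1)%N%:R <= n%:R / N.
  by rewrite -LD; apply: exp_ball_bound => //; rewrite LD.
have bad_n : (d.+1 ^ (4 * k).+1 < n)%N.
  rewrite -(ltr_nat R); apply: le_lt_trans badN _.
  by rewrite ltr_pdivrMr // ltr_pMr // (lt_le_trans _ N2) // ltr1n.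
have sn : (s <= n)%N.
  apply: leq_trans sd _; apply: leq_trans (ltnW bad_n).
  by rewrite expnS (leq_trans (leqnSn d)) // leq_pmulr // expn_gt0.
apply: le_trans (eig_count_finite reg (ltnW d2) s1 sd sk q bad_n sn e1) _.
apply: le_trans total; apply: lerD (lerD q_le badN) _.
have N2E : expR (- (2 * l)) = (N ^+ 2)^-1.
  by rewrite expRN expRM_natl -NE.
apply: residual_bound => //; first exact: le_trans factor LN.
- rewrite -N2E; exact: (few_small_walks d2 dE s1 sd (ltW L0) k64).
rewrite -N2E; apply: le_trans (onem_exp_le _ _) _.
  by rewrite ler_pdivrMr // mul1r ler_nat.
rewrite ler_pdivrMr // in q_ge.
by rewrite ler_expR lerN2 mulrAC ler_pdivlMr // [X in _ <= X]mulrC.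
Qed.
End Estimates.

(** * Deduction of the two regimes *)

Local Open Scope classical_set_scope.

Lemma ln_ln_ge1 (R : realType) :
  exists n0 : nat, forall n, (n0 <= n)%N -> 1 <= ln (ln n%:R : R).
Proof.
exists (Num.truncn (expR (expR 1) : R)).+1 => n n0.
have : expR (expR 1) <= n%:R :> R.
  by rewrite (le_trans (ltW (truncnS_gt _))) // ler_nat.
rewrite -[X in _ -> X <= _](@expRK R) -[X in _ -> ln X <= _](@expRK R) => H.
have n1 := lt_le_trans (expR_gt0 _) H.
have H1 : expR 1 <= ln n%:R :> R.
  by rewrite -ler_expR lnK.
by rewrite ler_ln ?posrE ?expRK ?expR_gt0 // (lt_le_trans (expR_gt0 1)).
Qed.

Theorem theorem1p7 (R : realType) (d : nat -> nat)
    (d_ge2 : forall n, (2 <= d n)%N) :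
  let dR (n : nat) : R^o := (d n)%:R in
  let log14 (n : nat) : R^o := ln n%:R `^ (1 / 4) in
  let admissible n (G : sgraph n) := regular (d n) G /\ connected_graph G in
  let m n (G : sgraph n) : R :=
    let A : 'M[R]_n := nadjmx R (d n) G in
    let L : R := log (dR n) n%:R in
    (eig_count A `[(1 - ln L / L) * lambda A 2, lambda A 2]%R)%:R in
  (dR =o_\oo log14 ->
     softO admissible m (fun n => n%:R / dR n)) /\
  (dR =Omega_\oo log14 ->
     softO admissible m
       (fun n => n%:R * ln (dR n) `^ (1 / 2) / ln n%:R `^ (1 / 4))).
Proof.
move=> dR log14 admissible m; have [n1 ll1] := ln_ln_ge1 R.
have [K K2 count_le] := eig_count_uniform R; have K0 : 0 < K by lra.
split.
(* Little-o is used with constant 1: eventually [d] is at most the fourth root of [ln n]. Then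
   [ln d <= l], the minimum is at least [d / l], and [l ^+ 2] is absorbed by the power [K >= 2]. *)
- move=> /eqoP/(_ 1 ltr01)[n2 _ dn]; exists K; split; first exact: K0.
  exists (maxn n1 n2) => n; rewrite geq_max => /andP[/ll1 l1 /dn /= {}dn] G [reg _].
  rewrite /m /dR (le_trans (count_le _ _ G (d_ge2 n) reg l1)) // -!mulrA ler_pM2l //.
  move: dn; rewrite mul1r /dR /log14 !ger0_norm ?powR_ge0 // => dn.
  have dR2 : (2 : R) <= (d n)%:R by rewrite ler_nat.
  set N := ln (n%:R : R) in l1 dn *; set l := ln N in l1 *; set D := ln _.
  have D0 : 0 < D by rewrite ln_gt0 //; lra.
  have N0 : 0 < N.
    rewrite ltNge; apply/negP => N0.
    by have := @ln_le0 R _ (le_trans N0 ler01); rewrite -/l; lra.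
  have l0 : 0 < l by lra.
  set mm := Num.min _ _.
  have Dl : D `^ (1 / 2) <= l.
    have Dl : D <= l.
      apply: (@le_trans _ _ (ln (N `^ (1 / 4)))).
        by rewrite ler_ln ?posrE ?powR_gt0 //; lra.
      by rewrite ln_powR -/l; lra.
    apply: (@le_trans _ _ (l `^ (1 / 2))); last by apply: ler1_powR => //; lra.
    by apply: ge0_ler_powR => //; rewrite nnegrE ltW.
  have mm_ge : (d n)%:R / l <= mm.
    rewrite le_min ler_pdivrMr // ler_peMr //=.
    apply: ler_pM => //; first by rewrite invr_ge0 ltW.
    by rewrite lef_pV2 ?posrE ?powR_gt0.
  have d0 : 0 < (d n)%:R :> R by lra.
  have mm0 : 0 < mm by apply: lt_le_trans mm_ge; rewrite divr_gt0.
  rewrite [X in _ <= X]mulrCA ler_wpM2l //.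
  rewrite (@le_trans _ _ (l * (l / (d n)%:R))) //.
    rewrite ler_pM2l // -[l / _]invf_div lef_pV2 ?posrE //.
    by rewrite divr_gt0.
  rewrite mulrA ler_wpM2r ?invr_ge0 ?(ltW d0) //.
  by rewrite -expr2 -powR_mulrn ?(ltW l0) // ler_powR.
- rewrite eqOmegaE qualifE => /asboolP[c c0 [n2 _ dn]].
  (* The square root [h] of [ln d] may be below 1, but it is at least 1/2; the halving of [c] pays
     for this in the bound of the minimum by [c' * (y / h)]. *)
  pose c' := Num.min 1 (c / 2).
  have c'0 : 0 < c' by rewrite lt_min ltr01 divr_gt0.
  (* The same constant is factor and exponent; it is at least 1 because [c' <= 1], so the single
     factor [l] is absorbed. *)
  exists (K / c'); split; first by rewrite divr_gt0.
  exists (maxn n1 n2) => n; rewrite geq_max => /andP[/ll1 l1 /dn /= {}dn] G [reg _].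
  rewrite /m /dR (le_trans (count_le _ _ G (d_ge2 n) reg l1)) // -!mulrA ler_pM2l //.
  move: dn; rewrite /dR /log14 !ger0_norm ?powR_ge0 // => dn.
  have dR2 : (2 : R) <= (d n)%:R by rewrite ler_nat.
  set N := ln (n%:R : R) in l1 dn *; set l := ln N in l1 *; set D := ln _.
  have D0 : 0 < D by rewrite ln_gt0 //; lra.
  have N0 : 0 < N.
    rewrite ltNge; apply/negP => N0.
    by have := @ln_le0 R _ (le_trans N0 ler01); rewrite -/l; lra.
  have l0 : 0 < l by lra.
  set mm := Num.min _ _.
  set y := N `^ (1 / 4) in dn mm *; set h := D `^ (1 / 2) in mm *.
  have y0 : 0 < y by rewrite powR_gt0.
  have h0 : 0 < h by rewrite powR_gt0.
  have h2 : 2^-1 <= h.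
    have D2 : 2^-1 <= D.
      have : ln 2 <= D by rewrite ler_ln ?posrE //; lra.
      apply: le_trans; have := @le_ln1Dx R (- 2^-1) ltac:(lra).
      rewrite (_ : 1 + - 2^-1 = 2^-1); last by field.
      by rewrite lnV ?posrE //; lra.
    have hh : h * h = D.
      rewrite /h -powRD ?(gt_eqF D0) ?implybT // (_ : 1 / 2 + 1 / 2 = 1).
        by rewrite powRr1 // ltW.
      by field.
    rewrite leNgt; apply/negP => H; have : h * h < 2^-1 * 2^-1 by rewrite ltr_pM // ltW.
    rewrite hh; lra.
  have mm_ge : c' * (y / h) <= mm.
    rewrite le_min; apply/andP; split.
      rewrite (@le_trans _ _ (c / 2 * (y / h))) //.
        by rewrite ler_pM2r ?divr_gt0 // ge_min lexx orbT.
      apply: le_trans dn; rewrite -mulrA ler_pM2l // mulrCA ler_piMr ?(ltW y0) //.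
      by rewrite ler_pdivrMr // mul1r.
    by rewrite ler_piMl ?divr_ge0 ?(ltW y0) ?(ltW h0) // ge_min lexx.
  have mm0 : 0 < mm by apply: lt_le_trans mm_ge; rewrite mulr_gt0 ?divr_gt0.
  have mV : mm^-1 <= c'^-1 * (h / y).
    rewrite -[h / y]invf_div -invfM lef_pV2 ?posrE // mulr_gt0 ?divr_gt0 //.
  have lC : l <= l `^ (K / c').
    apply: le1r_powR => //; rewrite ler_pdivlMr // mul1r.
    by rewrite (@le_trans _ _ 1) ?ge_min ?lexx //; lra.
  rewrite (@le_trans _ _ (n%:R * (l * (c'^-1 * (h / y))))) //.
    by rewrite !ler_wpM2l // ltW.
  rewrite (_ : n%:R * (l * (c'^-1 * (h / y))) = c'^-1 * (l * (n%:R * (h / y)))); last by ring.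
  rewrite ler_wpM2l ?invr_ge0 ?(ltW c'0) // ler_wpM2r //.
  by rewrite !mulr_ge0 ?invr_ge0 ?(ltW y0) ?(ltW h0).
Qed.
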